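(* Work in the setting and with the assumptions (quasi-strong convexity, dependence/bias, expected smoothness, gradient noise) and functional forms of $\gamma_t,\nu_t,\sigma_t,n_t$ described in the context, the last three assumptions being taken with $p=2$. Let $\delta_t=\mathbb{E}[\lVert\theta_t-\theta^*\rVert^2]$, where $(\theta_t)$ follows either the recursion (SSG) or the recursion (PSSG). If $$\mu_\nu=\mu-\mathbf 1_{\{\rho=0\}}\,2D_\nu C_\rho^{-\nu}>0,$$ then there exist explicit constants $C_\delta,C_\delta',C_\delta''>0$ such that for $\alpha-\rho\beta\in(1/2,1)$, $$\delta_t\le \mathcal{O}\left(\exp\left(-\frac{\mu C_\gamma N_t^{\frac{1+\rho\beta-\alpha}{1+\rho}}}{C_\delta C_\rho^{\frac{1-\beta-\alpha}{1+\rho}}}\right)\right)+\frac{C_\delta' B_\nu^2}{\mu\mu_\nu C_\rho^{\frac{2\nu}{1+\rho}}N_t^{\frac{2\rho\nu}{1+\rho}}}+\frac{C_\delta'' C_\sigma^2C_\gamma}{\mu_\nu C_\rho^{\frac{2\sigma-\beta-\alpha}{1+\rho}}N_t^{\frac{\rho(2\sigma-\beta)+\alpha}{1+\rho}}}.$$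
   Context: Setting. $\Theta\subseteq\mathbb{R}^d$ is a closed convex set; the objective function $F(\theta)=\mathbb{E}_\xi[f(\theta;\xi)]$, $\theta\in\mathbb{R}^d$, has a unique global minimizer $\theta^*\in\Theta$. At each $t\ge1$ a mini-batch of $n_t\in\mathbb{N}$ differentiable random loss functions $f_{t,1},\dots,f_{t,n_t}$ arrives; $f_t$ denotes the mini-batch loss, with $\nabla_\theta f_t(\theta)=n_t^{-1}\sum_{i=1}^{n_t}\nabla_\theta f_{t,i}(\theta)$. $\mathcal F_t=\sigma(f_i:i\le t)$ and $N_t=\sum_{i=1}^t n_i$. The recursions start at some $\theta_0\in\Theta$. Recursions. (SSG): $\theta_t=\theta_{t-1}-\frac{\gamma_t}{n_t}\sum_{i=1}^{n_t}\nabla_\theta f_{t,i}(\theta_{t-1})$. (PSSG): $\theta_t=\mathcal P_\Theta\big(\theta_{t-1}-\frac{\gamma_t}{n_t}\sum_{i=1}^{n_t}\nabla_\theta f_{t,i}(\theta_{t-1})\big)$, with $\mathcal P_\Theta$ the Euclidean projection onto $\Theta$. Assumptions (the last three for a positive integer $p$): - Quasi-strong convexity: $F$ is differentiable with $\nabla_\theta F(\theta^* )=0$, and there is $\mu>0$ such that for all $\theta\in\Theta$, $F(\theta^* )\ge F(\theta)+\langle\nabla_\theta F(\theta),\theta^*-\theta\rangle+\frac\mu2\lVert\theta^*-\theta\rVert^2$. - Dependence/bias: for each $t\ge1$, the random function $\nabla_\theta f_t$ is square-integrable and $\mathcal F_t$-measurable, and there are a positive sequence $(\nu_t)_{t\ge1}$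 and constants $D_\nu,B_\nu\ge0$ such that, for $\theta\in\Theta$, $\mathbb{E}[\lVert\mathbb{E}[\nabla_\theta f_t(\theta)\mid\mathcal F_{t-1}]-\nabla_\theta F(\theta)\rVert^p]\le\nu_t^p(D_\nu^p\mathbb{E}[\lVert\theta-\theta^*\rVert^p]+B_\nu^p)$. - Expected smoothness: there is $C_\kappa>0$ such that for all $\theta\in\Theta$, $\mathbb{E}[\lVert\nabla_\theta f_t(\theta)-\nabla_\theta f_t(\theta^* )\rVert^p]\le C_\kappa^p\mathbb{E}[\lVert\theta-\theta^*\rVert^p]$. - Gradient noise: there is a positive sequence $(\sigma_t)_{t\ge1}$ such that $\mathbb{E}[\lVert\nabla_\theta f_t(\theta^* )\rVert^p]\le\sigma_t^p$. Functional forms. $n_t=\lceil C_\rho t^\rho\rceil$ with $C_\rho\in\mathbb{N}$, $\rho\in[0,1)$; $\gamma_t=C_\gamma n_t^\beta t^{-\alpha}$ with $C_\gamma>0$, $\beta\in[0,1]$; $\nu_t=n_t^{-\nu}$ with $\nu\in(0,\infty)$; $\sigma_t=C_\sigma n_t^{-\sigma}$ with $C_\sigma>0$, $\sigma\in[0,1/2]$.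
   Formalization: For (SSG) the iterates are additionally assumed to stay in Θ almost surely (automatic if Θ=R^d), since the assumptions control gradients only on Θ; θ in the dependence/bias and smoothness conditions is read as any Θ-valued F_{t-1}-measurable random point with finite second moment. *)

(* Defs.v *)
From HB Require Import structures.
From mathcomp Require Import all_boot all_order all_algebra.
From mathcomp Require Import all_classical all_reals all_analysis.

Set Implicit Arguments.
Unset Strict Implicit.
Unset Printing Implicit Defensive.

Import Order.TTheory GRing.Theory Num.Theory.
Import numFieldNormedType.Exports.

Local Open Scope classical_set_scope.
Local Open Scope ring_scope.

(* The library norm on 'rV[R]_d is the sup norm, so the Euclidean structure is
   set up here.  The topology and [differentiable] do not depend on the choice
   of norm. *)
Section euclidean.
Context {R : realType} {d : nat}.
Implicit Types (u v x : 'rV[R]_d) (S : set 'rV[R]_d).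

Definition dotp u v : R := \sum_(j < d) u 0 j * v 0 j.

Definition enorm u : R := Num.sqrt (dotp u u).

Definition grad (f : 'rV[R]_d -> R) x : 'rV[R]_d :=
  \row_j 'd f x (delta_mx 0 j).

(* Graph of the Euclidean projection onto S : y = P_S(x). *)
Definition is_projection S x y :=
  S y /\ forall z, S z -> enorm (x - y) <= enorm (x - z).

Definition is_unique_global_minimizer (F : 'rV[R]_d -> R) x :=
  (forall y, F x <= F y) /\ (forall y, (forall z, F y <= F z) -> y = x).

Definition quasi_strongly_convex S (F : 'rV[R]_d -> R) xstar (mu : R) :=
  [/\ forall x, differentiable F x,
      grad F xstar = 0,
      0 < mu
    & forall x, S x ->
        F xstar >= F x + dotp (grad F x) (xstar - x)
                   + mu / 2 * enorm (xstar - x) ^+ 2].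

End euclidean.

(* F(x) = E_xi[loss(x; xi)], Q being the law of xi. *)
Definition objective {R : realType} {dX} {X : measurableType dX}
    (Q : probability X R) {d} (loss : 'rV[R]_d -> X -> R) (x : 'rV[R]_d) : R :=
  fine 'E_Q[loss x].

Section streaming.
Context {R : realType} {dO : measure_display} {Omega : measurableType dO}.
Context (P : probability Omega R) {d : nat}.
Implicit Types (G : set (set Omega)) (t i p : nat) (Theta : set 'rV[R]_d).

Definition rv_measurable G (X : Omega -> R) :=
  forall B : set R, measurable B -> G (X @^-1` B).

Definition rvec_measurable G (X : Omega -> 'rV[R]_d) :=
  forall j, rv_measurable G (fun w => X w 0 j).

(* Measurability of a random field w |-> (x |-> h w x) is joint
   measurability for the product of G with the Borel sigma-algebra of R^d. *)
Definition rfield_measurable G (h : Omega -> 'rV[R]_d -> 'rV[R]_d) :=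
  forall j (B : set R), measurable B ->
    <<s [set A `*` U | A in G & U in [set U : set 'rV[R]_d | open U] ] >>
      [set wx : Omega * 'rV[R]_d | B (h wx.1 wx.2 0 j)].

(* E[ ||Z||^p ] *)
Definition moment p (Z : Omega -> 'rV[R]_d) : \bar R :=
  'E_P[fun w => enorm (Z w) ^+ p].

(* Y is a version of E[X | G], coordinatewise. *)
Definition is_cond_expectation G (X Y : Omega -> 'rV[R]_d) :=
  rvec_measurable G Y /\
  forall j,
    [/\ P.-integrable setT (EFin \o (fun w => X w 0 j)),
        P.-integrable setT (EFin \o (fun w => Y w 0 j))
      & forall A, G A ->
          (\int[P]_(w in A) (Y w 0 j)%:E = \int[P]_(w in A) (X w 0 j)%:E)%E].

Section losses.
(* n t is the size of the t-th mini-batch and f t i (for i < n t, t >= 1) its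
   i-th random loss. *)
Context (n : nat -> nat) (f : nat -> nat -> Omega -> 'rV[R]_d -> R).

Definition random_losses :=
  forall t i, (0 < t)%N -> (i < n t)%N ->
    (forall x, measurable_fun setT (fun w => f t i w x)) /\
    (forall w x, differentiable (f t i w) x).

Definition batch_loss t (w : Omega) (x : 'rV[R]_d) : R :=
  (n t)%:R^-1 * \sum_(i < n t) f t i w x.

Definition batch_grad t (w : Omega) (x : 'rV[R]_d) : 'rV[R]_d :=
  grad (batch_loss t w) x.

(* F_t = sigma(f_i : 1 <= i <= t), a random function being identified with the
   family of its values; in particular F_0 is trivial. *)
Definition filtration t : set (set Omega) :=
  <<s [set A | exists i x (B : set R),
        [/\ (1 <= i <= t)%N, measurable B
          & A = (fun w => batch_loss i w x) @^-1` B] ] >>.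

(* The points x at which the moment assumptions are imposed: they are random,
   Theta-valued and F_{t-1}-measurable (like the iterate x_{t-1}), with a
   finite moment of order p. *)
Definition admissible p Theta (xstar : 'rV[R]_d) t
    (x : Omega -> 'rV[R]_d) :=
  [/\ forall w, Theta (x w),
      rvec_measurable (filtration t.-1) x
    & (moment p (fun w => (x w - xstar)%R) < +oo)%E].

Definition dependence_bias p Theta (F : 'rV[R]_d -> R) (xstar : 'rV[R]_d)
    (nu_ : nat -> R) (D B : R) :=
  forall t, (0 < t)%N ->
    [/\ 0 < nu_ t,
        rfield_measurable (filtration t) (batch_grad t),
        (forall x, Theta x ->
          (moment 2 (fun w => batch_grad t w x) < +oo)%E)
      & forall x, admissible p Theta xstar t x ->
          exists2 Y,
            is_cond_expectation (filtration t.-1)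
              (fun w => batch_grad t w (x w)) Y
          & (moment p (fun w => (Y w - grad F (x w))%R) <=
             (nu_ t ^+ p)%:E *
               ((D ^+ p)%:E * moment p (fun w => (x w - xstar)%R)
                + (B ^+ p)%:E))%E].

Definition expected_smoothness p Theta (xstar : 'rV[R]_d) (Ck : R) :=
  forall t, (0 < t)%N -> forall x, admissible p Theta xstar t x ->
    (moment p (fun w => (batch_grad t w (x w) - batch_grad t w xstar)%R)
     <= (Ck ^+ p)%:E * moment p (fun w => (x w - xstar)%R))%E.

Definition gradient_noise p (xstar : 'rV[R]_d) (sigma_ : nat -> R) :=
  forall t, (0 < t)%N -> 0 < sigma_ t /\
    (moment p (fun w => batch_grad t w xstar) <= (sigma_ t ^+ p)%:E)%E.

Definition sgd_step (gamma_ : nat -> R) t (w : Omega) (x : 'rV[R]_d) :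
    'rV[R]_d :=
  x - (gamma_ t / (n t)%:R) *: \sum_(i < n t) grad (f t i w) x.

(* Unprojected recursion.  The assumptions only control the gradients on
   Theta, so the iterates are required to remain in Theta almost surely (no
   restriction when Theta is the whole space). *)
Definition SSG Theta (gamma_ : nat -> R) (x0 : 'rV[R]_d)
    (x_ : nat -> Omega -> 'rV[R]_d) :=
  [/\ forall w, x_ 0%N w = x0,
      forall t w, x_ t.+1 w = sgd_step gamma_ t.+1 w (x_ t w)
    & forall t, {ae P, forall w, Theta (x_ t w)}].

Definition PSSG Theta (gamma_ : nat -> R) (x0 : 'rV[R]_d)
    (x_ : nat -> Omega -> 'rV[R]_d) :=
  (forall w, x_ 0%N w = x0) /\
  (forall t w, is_projection Theta (sgd_step gamma_ t.+1 w (x_ t w))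
                 (x_ t.+1 w)).

End losses.
End streaming.

Section schedules.
Context {R : realType}.
Implicit Types (rho alpha beta nu sigma : R) (Crho t : nat).

Definition batch_size Crho rho t : nat :=
  `| Num.ceil (Crho%:R * t%:R `^ rho) |%N.

Definition total_size Crho rho t : nat :=
  (\sum_(1 <= i < t.+1) batch_size Crho rho i)%N.

Definition learning_rate (Cgamma : R) beta alpha Crho rho t : R :=
  Cgamma * (batch_size Crho rho t)%:R `^ beta * t%:R `^ (- alpha).

Definition bias_rate nu Crho rho t : R :=
  (batch_size Crho rho t)%:R `^ (- nu).

Definition noise_rate (Csigma : R) sigma Crho rho t : R :=
  Csigma * (batch_size Crho rho t)%:R `^ (- sigma).

Definition mu_nu (mu D : R) nu Crho rho : R :=
  mu - (rho == 0)%:R * (2 * D * Crho%:R `^ (- nu)).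

End schedules.

(* Main.v *)
(* Quasi-strong convexity together with minimality of [theta*] gives quadratic
   growth along segments, hence [<grad F(x), x - theta*> >= mu |x - theta*|^2] on
   [Theta].  Conditioning on the past replaces the stochastic gradient by a
   version of its conditional expectation, and the weighted AM-GM inequality
   absorbs the bias, so that, whichever recursion is followed,
     delta_t <= (1 - gamma_t (3 mu / 2 - 2 D nu_t) + 2 C^2 gamma_t^2) delta_{t-1}
                + gamma_t (2 nu_t^2 B^2 / mu + 2 gamma_t sigma_t^2).
   Since [mu_nu > 0], [2 D nu_t <= mu] for large [t], so the contraction factor is
   eventually at most [1 - gamma_t mu / 4].  Comparing [n_t] with [Crho t^rho], the
   forcing term is at most a sum of powers [t^-e] times [gamma_t], and multiples of
   these powers are supersolutions because [gamma_t] decays slower than [1 / t].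
   What remains decays like [exp (- mu / 4 * sum gamma_i)]. *)
Require Import Defs.
From HB Require Import structures.
From mathcomp Require Import all_boot all_order all_algebra.
From mathcomp Require Import all_classical all_reals all_analysis.
From mathcomp Require Import measurable_realfun ring lra.
Import Order.TTheory GRing.Theory Num.Theory.
Import numFieldNormedType.Exports.
Local Open Scope classical_set_scope.
Local Open Scope ring_scope.
Set Implicit Arguments.
Unset Strict Implicit.
Unset Printing Implicit Defensive.

(** * Euclidean geometry and quasi-strong convexity *)

(** The contraction holds only from some time on, while the bound is claimed for every [t >= 1]. The
    remainder [g] is therefore the positive part of [delta] minus the two explicit terms: it covers
    any finite start and is constrained only at infinity. The three constants depend on [rho],
    [beta], [nu], [sigma] but are fixed before [alpha] and all problem data, so factors whose
    exponent involves [alpha] are rounded to absolute numbers.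

    The argument naturally yields [mu] where the bound has [mu_nu]; since [mu_nu <= mu], passing to
    [mu_nu] only enlarges the right-hand side.

    Two measure-theoretic obstacles shape the middle of the proof. A conditional expectation is
    known only through integrals over past events, whereas it must be paired with the unbounded
    vector [x_t - theta*]; simple functions and truncation bridge the gap. The projection is a
    relation rather than a map, so the measurability of the projected iterates is drawn from
    nonexpansiveness. *)

Section euclidean_theory.
Context {R : realType} {d : nat}.
Implicit Types (u v x y : 'rV[R]_d) (S : set 'rV[R]_d).

Lemma dotpC u v : dotp u v = dotp v u.
Proof. by apply: eq_bigr => j _; rewrite mulrC. Qed.

Lemma dotpDl u v x : dotp (u + v) x = dotp u x + dotp v x.
Proof. by rewrite -big_split; apply: eq_bigr => j _; rewrite !mxE mulrDl. Qed.

Lemma dotpZl a u v : dotp (a *: u) v = a * dotp u v.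
Proof. by rewrite mulr_sumr; apply: eq_bigr => j _; rewrite !mxE mulrA. Qed.

Lemma dotpDr u v x : dotp x (u + v) = dotp x u + dotp x v.
Proof. by rewrite !(dotpC x) dotpDl. Qed.

Lemma dotpZr a u v : dotp u (a *: v) = a * dotp u v.
Proof. by rewrite !(dotpC u) dotpZl. Qed.

Lemma dotpNl u v : dotp (- u) v = - dotp u v.
Proof. by rewrite -scaleN1r dotpZl mulN1r. Qed.

Lemma dotpNr u v : dotp u (- v) = - dotp u v.
Proof. by rewrite !(dotpC u) dotpNl. Qed.

Lemma dotp_ge0 u : 0 <= dotp u u.
Proof. by apply: sumr_ge0 => j _; rewrite -expr2 sqr_ge0. Qed.

Lemma enorm_sqr u : enorm u ^+ 2 = dotp u u.
Proof. by rewrite sqr_sqrtr// dotp_ge0. Qed.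

Lemma enorm_ge0 u : 0 <= enorm u.
Proof. exact: sqrtr_ge0. Qed.

Lemma enorm0 : enorm (0 : 'rV[R]_d) = 0.
Proof.
by apply/eqP; rewrite -sqrf_eq0 enorm_sqr -(scale0r 0) dotpZl mul0r.
Qed.

Lemma ler_enorm u v : (enorm u <= enorm v) = (dotp u u <= dotp v v).
Proof. by rewrite ler_sqrt// dotp_ge0. Qed.

Lemma dotpDD u v : dotp (u + v) (u + v) = dotp u u + 2 * dotp u v + dotp v v.
Proof. by rewrite !(dotpDl, dotpDr) (dotpC v u); ring. Qed.

Lemma dotpBB u v : dotp (u - v) (u - v) = dotp u u - 2 * dotp u v + dotp v v.
Proof. by rewrite dotpDD dotpNl !dotpNr; ring. Qed.

Lemma sqr_coord_le_dotp u j : u 0 j ^+ 2 <= dotp u u.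
Proof.
rewrite /dotp (bigD1 j)//= -expr2 lerDl.
by apply: sumr_ge0 => i _; rewrite -expr2 sqr_ge0.
Qed.

Lemma normr_coord_le_enorm u j : `|u 0 j| <= enorm u.
Proof. by rewrite -sqrtr_sqr ler_sqrt ?dotp_ge0// sqr_coord_le_dotp. Qed.

Lemma diff_dotp_grad (F : 'rV[R]_d -> R) x v :
  differentiable F x -> 'd F x v = dotp (grad F x) v.
Proof.
move=> dF; rewrite {1}(row_sum_delta v) linear_sum.
by apply: eq_bigr => j _; rewrite linearZ/= mxE mulrC.
Qed.

Lemma convex_setP S x y a :
  convex_set (S : set (convex_lmodType 'rV[R]_d)) -> S x -> S y ->
  0 <= a <= 1 -> S (x + a *: (y - x)).
Proof.
move=> cS Sx Sy a01; pose t : {i01 R} := @Itv01 R a (andP a01).1 (andP a01).2.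
have := cS y x t (mem_set Sy) (mem_set Sx); rewrite inE.
suff -> : conv t (y : convex_lmodType _) x = x + a *: (y - x) :> 'rV[R]_d by [].
rewrite [LHS](_ : _ = a *: y + (1 - a) *: x) //.
by rewrite scalerBl scale1r scalerBr addrCA.
Qed.

(** If the angle at [y] were acute, a short move from [y] towards [z] would stay in [S] by convexity
    and come closer to [x]. *)
Lemma is_projection_obtuse S x y z :
  convex_set (S : set (convex_lmodType 'rV[R]_d)) ->
  is_projection S x y -> S z -> dotp (x - y) (z - y) <= 0.
Proof.
move=> cS [Sy ymin] Sz; rewrite leNgt; apply/negP.
set a := dotp _ _ => a0; set b := dotp (z - y) (z - y).
have b0 : 0 <= b by exact: dotp_ge0.
have ab0 : 0 < a + b by rewrite ltr_pwDl.
(* Taken instead of the minimizer [a / b], this step lies in []0, 1]] without a case analysis, even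
   when [b] is 0; minimality of [y] then gives [2 * a <= s * b <= a]. *)
pose s := a / (a + b).
have s0 : 0 < s by rewrite divr_gt0.
have s1 : s <= 1 by rewrite ler_pdivrMr// mul1r lerDl.
have /ymin : S (y + s *: (z - y)) by apply: convex_setP => //; rewrite ltW.
rewrite ler_enorm opprD addrA [leRHS]dotpBB dotpZl !dotpZr -/a -/b => h.
have {h} h : 2 * a <= s * b by rewrite -(ler_pM2l s0); lra.
have : s * b <= a.
  by rewrite mulrAC ler_pdivrMr// ler_pM2l// lerDr ltW.
by lra.
Qed.

(** The obtuse-angle inequalities at [y1] and [y2] add up to [dotp (y1 - y2) (y1 - y2) <= dotp (x1 -
    x2) (y1 - y2)]. Expanding the square of [(x1 - x2) - (y1 - y2)], which is nonnegative,
    concludes. *)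
Lemma is_projection_nonexpansive S x1 x2 y1 y2 :
  convex_set (S : set (convex_lmodType 'rV[R]_d)) ->
  is_projection S x1 y1 -> is_projection S x2 y2 ->
  enorm (y1 - y2) <= enorm (x1 - x2).
Proof.
move=> cS h1 h2; rewrite ler_enorm.
have := is_projection_obtuse cS h1 h2.1.
have := is_projection_obtuse cS h2 h1.1.
have : 0 <= dotp ((x1 - x2) - (y1 - y2)) ((x1 - x2) - (y1 - y2)).
  exact: dotp_ge0.
rewrite !(dotpDl, dotpDr, dotpNl, dotpNr).
rewrite !(dotpC x2 x1, dotpC y1 x1, dotpC y2 x1, dotpC y1 x2, dotpC y2 x2,
          dotpC y2 y1).
by lra.
Qed.

Lemma is_projection_id S x : S x -> is_projection S x x.
Proof. by move=> Sx; split=> // z Sz; rewrite subrr enorm0 enorm_ge0. Qed.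

Lemma is_derive_line (F : 'rV[R]_d -> R) x v (s : R) :
  differentiable F (x + s *: v) ->
  is_derive s 1 (fun s => F (x + s *: v)) (dotp (grad F (x + s *: v)) v).
Proof.
move=> dF; have /derivableP[dv vE] := @diff_derivable _ _ _ F _ v dF.
have E : (fun h : R => h^-1 *: (((fun s => F (x + s *: v)) \o shift s) (h *: 1)
                       - F (x + s *: v))) =
   (fun h : R => h^-1 *: ((F \o shift (x + s *: v)) (h *: v) - F (x + s *: v))).
  by apply/funext => h /=; rewrite scalerDl /GRing.scale/= mulr1 addrCA.
split; first by rewrite /derivable E.
by rewrite /derive E -diff_dotp_grad// -deriveE.
Qed.

(* Along the segment from [xs] to [x], [(F - F xs) / s - mu r^2 s / 2] is
   nondecreasing, and minimality of [xs] bounds it below by [- mu r^2 s / 2]. *)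
Lemma quasi_strongly_convex_growth S (F : 'rV[R]_d -> R) xs mu x :
  convex_set (S : set (convex_lmodType 'rV[R]_d)) -> S xs ->
  (forall y, F xs <= F y) -> quasi_strongly_convex S F xs mu -> S x ->
  mu / 2 * dotp (x - xs) (x - xs) <= F x - F xs.
Proof.
move=> cS Sxs Fmin [dF _ mu0 qsc] Sx.
set v := x - xs; set k := mu / 2 * dotp v v.
have k0 : 0 <= k by rewrite mulr_ge0 ?dotp_ge0// divr_ge0// ltW.
pose phi s := F (xs + s *: v).
pose psi (s : R) := s^-1 * (phi s - F xs) - k * s.
pose dpsi (s : R) :=
  s^-1 * dotp (grad F (xs + s *: v)) v - s ^- 2 * (phi s - F xs) - k.
have dpsiE (s : R) : 0 < s -> is_derive s 1 psi (dpsi s).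
  move=> s0; have ? := @is_derive_line F xs v s (dF _).
  have sn0 : s != 0 by rewrite gt_eqF.
  have ? : is_derive s 1 (fun s : R => s^-1) (- s ^- 2).
    by have := @is_deriveV _ (@id R) s 1 1 sn0; rewrite scaler1; apply.
  rewrite /psi; apply: is_derive_eq.
  rewrite /dpsi /GRing.scale/= /phi; field.
  by rewrite gt_eqF.
have dpsi_ge0 s : 0 < s <= 1 -> 0 <= dpsi s.
  move=> /andP[s0 s1].
  have := qsc _ (convex_setP cS Sxs Sx (_ : 0 <= s <= 1)).
  rewrite ltW// => /(_ s1); rewrite -/v enorm_sqr.
  rewrite opprD addrA subrr sub0r -scaleNr dotpZl !dotpZr -/(phi s) => h.
  (* Multiplied by [s ^+ 2], nonnegativity of the derivative is quasi-strong convexity at the point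
     [xs + s *: v]. *)
  have -> : dpsi s = s ^- 2 * (s * dotp (grad F (xs + s *: v)) v
     - (phi s - F xs) - s ^+ 2 * k) by rewrite /dpsi; field; rewrite gt_eqF.
  rewrite mulr_ge0 ?invr_ge0 ?sqr_ge0//.
  by rewrite /k; lra.
have psi1 (s : R) : 0 < s < 1 -> psi s <= psi 1.
  move=> /andP[s0 s1]; rewrite -subr_ge0.
  have [||c] := @MVT_segment _ psi dpsi s 1 (ltW s1).
  - move=> y; rewrite in_itv/= => /andP[sy y1].
    exact/dpsiE/(lt_trans s0).
  - apply: derivable_within_continuous => y; rewrite in_itv/= => /andP[sy y1].
    by have [] := dpsiE y (lt_le_trans s0 sy).
  rewrite in_itv/= => /andP[sc c1] ->.
  by apply: mulr_ge0; [rewrite dpsi_ge0// (lt_le_trans s0)|rewrite subr_ge0 ltW].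
have psi_ge (s : R) : 0 < s -> - (k * s) <= psi s.
  move=> s0; rewrite lerDr; apply: mulr_ge0; first by rewrite invr_ge0 ltW.
  by rewrite subr_ge0; exact: Fmin.
have : 0 <= psi 1.
  rewrite leNgt; apply/negP => p0.
  (* If [psi 1 < 0], then [- (k * s) <= psi s <= psi 1] fails once [k * s] is at most half of
     [- psi 1]. The [k + 1] keeps the quotient meaningful when [k] is 0. *)
  pose s := Num.min (2^-1) (- psi 1 / (2 * (k + 1))).
  have k1 : 0 < k + 1 by rewrite ltr_wpDl.
  have s0 : 0 < s by rewrite lt_min invr_gt0 ltr0n/= divr_gt0 ?mulr_gt0 ?oppr_gt0.
  have s1 : s < 1 by rewrite gt_min invf_lt1// ltr1n.
  have sk : s * (2 * (k + 1)) <= - psi 1.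
    by rewrite -ler_pdivlMr ?mulr_gt0// ge_min lexx orbT.
  have := psi1 s; rewrite s0 s1 => /(_ isT); have := psi_ge s s0.
  have : 0 <= s * k by rewrite mulr_ge0// ltW.
  by lra.
have -> : F x = phi 1 by rewrite /phi scale1r /v addrC subrK.
by rewrite /psi invr1 -/k; lra.
Qed.

(** Quasi-strong convexity at [x] contributes one half of [mu] together with [F x - F xs]; quadratic
    growth turns this gap into the other half. *)
Lemma quasi_strongly_convex_monotone S (F : 'rV[R]_d -> R) xs mu x :
  convex_set (S : set (convex_lmodType 'rV[R]_d)) -> S xs ->
  (forall y, F xs <= F y) -> quasi_strongly_convex S F xs mu -> S x ->
  mu * dotp (x - xs) (x - xs) <= dotp (grad F x) (x - xs).
Proof.
move=> cS Sxs Fmin qscF Sx.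
have := quasi_strongly_convex_growth cS Sxs Fmin qscF Sx.
have [_ _ _ /(_ _ Sx)] := qscF.
by rewrite -(opprB x xs) enorm_sqr dotpNl !dotpNr; lra.
Qed.

End euclidean_theory.

(** * Measurability of random vectors *)

Section measurable_vectors.
Context {R : realType} {d : nat} {dT : measure_display} {T : measurableType dT}.
Implicit Types (h k : T -> 'rV[R]_d) (V : set 'rV[R]_d).

(** Stated over an arbitrary measurable type, so that it also applies to [g_sigma_algebraType gens],
    where it expresses [rvec_measurable]. *)
Definition measurable_vec h := forall j, measurable_fun setT (fun w => h w 0 j).

(** An open set is the union of the rational boxes it contains. There are countably many of them,
    and the preimage of a box is a finite intersection of coordinate events. *)
Lemma measurable_vec_open h V : measurable_vec h -> open V -> measurable (h @^-1` V).
Proof.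
move=> mh oV.
pose box (c : 'rV[rat]_d * rat) : set 'rV[R]_d :=
  [set x | forall j, `|x 0 j - ratr (c.1 0 j)| < ratr c.2].
have -> : V = \bigcup_c (if `[< box c `<=` V >] then box c else set0).
  apply/seteqP; split=> [x Vx|x [c _]]; last by case: asboolP => // + bx; exact.
  have /nbhs_ballP[e /= e0 eV] := oV _ Vx.
  (* With [r < e / 2] and a rational centre within [r] of [x], the box of radius [r] contains [x]
     and stays in the ball of radius [e]. *)
  have [r] := rat_in_itvoo (divr_gt0 e0 (ltr0n R 2)).
  rewrite in_itv/= => /andP[r0 re].
  have /choice[q hq] (j : 'I_d) : exists q : rat, `|x 0 j - ratr q| < ratr r.
    have [|q] := @rat_in_itvoo R (x 0 j - ratr r) (x 0 j + ratr r).
      by rewrite ltrBlDr -addrA ltrDl addr_gt0.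
    by rewrite in_itv/= => qx; exists q; rewrite distrC ltr_distl.
  exists (\row_j q j, r) => //.
  have bx : box (\row_j q j, r) x by move=> j /=; rewrite mxE.
  case: asboolP => //; case=> y yb; apply: eV; split => // i j.
  rewrite ord1 /ball/=.
  have /= := yb j; rewrite mxE => yq.
  rewrite (le_lt_trans (ler_distD (ratr (q j)) _ _))//.
  by rewrite (splitr e) ltrD// (lt_trans _ re)// distrC.
rewrite preimage_bigcup; apply: countable_bigcupT_measurable => // c.
case: ifPn => _; last by rewrite preimage_set0.
rewrite [X in measurable X](_ : _ = \bigcap_(j in [set: 'I_d])
   ((fun w => h w 0 j) @^-1` ball (ratr (c.1 0 j) : R) (ratr c.2))).
  apply: fin_bigcap_measurable => // j _; rewrite -[X in measurable X]setTI.
  by apply: mh => //; rewrite ball_itv; exact: measurable_itv.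
apply/seteqP; split=> w /=.
  by move=> bw j _; rewrite /ball/= distrC.
by move=> bw j; have := bw j I; rewrite /ball/= distrC.
Qed.

Lemma measurable_vec_continuous h (F : 'rV[R]_d -> R) :
  measurable_vec h -> continuous F -> measurable_fun setT (F \o h).
Proof.
move=> mh /continuousP cF; apply: (measurability _ (RGenOpens.measurableE R)).
move=> _ [_ [a [b ->] <-]]; rewrite setTI comp_preimage.
exact/(measurable_vec_open mh)/cF/interval_open.
Qed.

Lemma continuous_dotp (a : 'rV[R]_d) :
  continuous (fun x : 'rV[R]_d => dotp (x - a) (x - a)).
Proof.
have cj (j : 'I_d) : continuous (fun x : 'rV[R]_d => (x - a) 0 j).
  rewrite (_ : (fun x : 'rV[R]_d => _) = (fun x : 'rV[R]_d => x 0 j - a 0 j)).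
    move=> x; apply: (@continuousB R _ _ (fun x : 'rV[R]_d => x 0 j) (fun=> a 0 j)).
      exact: coord_continuous.
    exact: cst_continuous.
  by apply/funext => x; rewrite !mxE.
apply: continuous_big => [|j _ x]; first exact: add_continuous.
apply: (@continuousM R _ (fun x : 'rV[R]_d => (x - a) 0 j)
                         (fun x : 'rV[R]_d => (x - a) 0 j)); exact: cj.
Qed.

Lemma continuous_enormB (a : 'rV[R]_d) :
  continuous (fun x : 'rV[R]_d => enorm (x - a)).
Proof.
move=> x; have := continuous_comp (continuous_dotp (a := a) (x := x)) (@sqrt_continuous R _).
by apply.
Qed.

(** The event [a < k w 0 j] is the preimage under [h] of a union of open balls, one around each
    [h w] with [a < k w 0 j], of radius [k w 0 j - a]: inside such a ball [k] moves by less than the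
    radius. The union may be uncountable, but it is open. This handles projections that are given
    only pointwise by a relation. *)
Lemma measurable_vec_contraction h k : measurable_vec h ->
  (forall w w', enorm (k w - k w') <= enorm (h w - h w')) -> measurable_vec k.
Proof.
move=> mh hk j; apply: (measurability _ (RGenOInfty.measurableE R)) => //.
move=> /= _ [_ [a ->] <-]; rewrite setTI preimage_itvoy.
pose V := \bigcup_(w in [set w | a < k w 0 j])
  [set y | enorm (y - h w) < k w 0 j - a].
rewrite [X in measurable X](_ : _ = h @^-1` V).
  apply: measurable_vec_open => //; apply: bigcup_open => w _.
  have /continuousP/(_ _ (@open_lt R (k w 0 j - a))) := @continuous_enormB (h w).
  exact.
apply/seteqP; split=> [w /= akw|w /= [w' /= akw' hw]].
  by exists w => //=; rewrite subrr enorm0 subr_gt0.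
have := le_lt_trans (le_trans (normr_coord_le_enorm _ j) (hk w w')) hw.
by rewrite !mxE ltr_norml => /andP[+ _]; rewrite opprB ltrBrDr subrK.
Qed.

(** A partial derivative is the pointwise limit of the difference quotients with steps [n.+1%:R^-1],
    each continuous in the base point. *)
Lemma measurable_vec_grad h (F : 'rV[R]_d -> R) : measurable_vec h ->
  (forall x, differentiable F x) -> measurable_vec (fun w => grad F (h w)).
Proof.
move=> mh dF j.
have cF : continuous F by move=> x; exact/differentiable_continuous/dF.
pose e n : 'rV[R]_d := n.+1%:R^-1 *: delta_mx 0 j.
apply: (@measurable_fun_cvg _ _ _ _
  (fun n w => n.+1%:R * (F (h w + e n) - F (h w)))) => [n|w _].
  apply: measurable_funM => //; apply: measurable_funB.
    apply: (@measurable_vec_continuous _ (fun x => F (x + e n))) => // x.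
    have ce : {for x, continuous (fun x : 'rV[R]_d => x + e n)}.
      by apply: (@continuousD R 'rV[R]_d 'rV[R]_d id (cst (e n)));
        [move=> ?; exact: cvg_id|exact: cst_continuous].
    by have := continuous_comp ce (cF _); apply.
  exact: measurable_vec_continuous.
rewrite mxE -deriveE; last exact: dF.
have /cvg_ex[l hl] : derivable F (h w) (delta_mx 0 j) by exact: diff_derivable.
rewrite /derive (cvg_lim _ hl)//.
have u0 : n.+1%:R^-1 @[n --> \oo] --> (0 : R)^'.
  move=> A /(@cvg_harmonic R)[N _ hN]; exists N => // n /hN; apply.
  by rewrite /harmonic/= invr_eq0 pnatr_eq0.
have -> : (fun n => n.+1%:R * (F (h w + e n) - F (h w))) =
    (fun s : R => s^-1 *: ((F \o shift (h w)) (s *: delta_mx 0 j) - F (h w))) \o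
    (fun n => n.+1%:R^-1).
  by apply/funext => n /=; rewrite invrK (addrC (h w)).
exact: cvg_comp u0 hl.
Qed.

Lemma measurable_vec_dotp h k : measurable_vec h -> measurable_vec k ->
  measurable_fun setT (fun w => dotp (h w) (k w)).
Proof.
move=> mh mk; rewrite /dotp; apply: measurable_sum => j.
exact: measurable_funM.
Qed.

Lemma measurable_vecD h k : measurable_vec h -> measurable_vec k ->
  measurable_vec (fun w => h w + k w).
Proof.
by move=> mh mk j; under eq_fun do rewrite mxE; exact: measurable_funD.
Qed.

Lemma measurable_vecZ a h : measurable_vec h -> measurable_vec (fun w => a *: h w).
Proof.
by move=> mh j; under eq_fun do rewrite mxE; exact: measurable_funM.
Qed.

Lemma measurable_vecB h k : measurable_vec h -> measurable_vec k ->
  measurable_vec (fun w => h w - k w).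
Proof.
move=> mh mk; apply: measurable_vecD => // j.
by under eq_fun do rewrite -scaleN1r; exact: measurable_vecZ.
Qed.

End measurable_vectors.

(** * Measurability with respect to a generated sub-sigma-algebra *)

Section sub_sigma_algebras.
Context {R : realType} {dO : measure_display} {Omega : measurableType dO} {d : nat}.
Implicit Types (gens : set (set Omega)) (h x : Omega -> 'rV[R]_d).

Lemma rv_measurableP gens (X : Omega -> R) :
  rv_measurable <<s gens>> X <->
  measurable_fun [set: g_sigma_algebraType gens] X.
Proof.
split=> [mX _ B mB|mX B mB]; first by rewrite setTI; exact: mX.
by have := mX measurableT B mB; rewrite setTI.
Qed.

Lemma rvec_measurableP gens h :
  rvec_measurable <<s gens>> h <->
  measurable_vec (h : g_sigma_algebraType gens -> 'rV[R]_d).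
Proof. by split=> mh j; apply/rv_measurableP; exact: mh. Qed.

Lemma rvec_measurable_vec gens h : <<s gens>> `<=` measurable ->
  rvec_measurable <<s gens>> h -> measurable_vec h.
Proof. by move=> sub mh j _ B mB; rewrite setTI; apply: sub; exact: mh. Qed.

(** The sets whose preimage under [w |-> (w, x w)] is in [<<s gens>>] form a sigma-algebra that
    contains the measurable rectangles. This makes the gradient at a random iterate measurable. *)
Lemma rfield_measurable_comp gens (h : Omega -> 'rV[R]_d -> 'rV[R]_d) x :
  rfield_measurable <<s gens>> h -> rvec_measurable <<s gens>> x ->
  rvec_measurable <<s gens>> (fun w => h w (x w)).
Proof.
move=> mh /rvec_measurableP mx j B mB.
pose S := [set A : set (Omega * 'rV[R]_d) | <<s gens>> ((fun w => (w, x w)) @^-1` A)].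
suff : <<s [set A `*` U | A in <<s gens>> & U in [set U : set 'rV[R]_d | open U] ] >> `<=` S.
  by move=> sub; have := sub _ (mh j B mB); rewrite /S /=; exact.
apply: smallest_sub => [|_ [A gA [U oU <-]]]; last first.
  rewrite /S/= (_ : _ @^-1` _ = A `&` x @^-1` U)//.
  have mA : (measurable : set (set (g_sigma_algebraType gens))) A by [].
  exact: (measurableI _ _ mA (measurable_vec_open mx oU)).
split.
- by rewrite /S/= preimage_set0; exact: (@measurable0 _ (g_sigma_algebraType gens)).
- move=> A SA; rewrite /S/= setTD preimage_setC.
  exact: (@measurableC _ (g_sigma_algebraType gens)).
- move=> F SF; rewrite /S/= preimage_bigcup.
  exact: (@bigcupT_measurable _ (g_sigma_algebraType gens)).
Qed.

Lemma closed_if_measurable gens (S : set 'rV[R]_d) c (h : Omega -> 'rV[R]_d) :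
  closed S -> rvec_measurable <<s gens>> h ->
  rvec_measurable <<s gens>> (fun w => if h w \in S then h w else c).
Proof.
move=> cS /rvec_measurableP mh; apply/rvec_measurableP => j.
have mA : (measurable : set (set (g_sigma_algebraType gens)))
    ((fun w => h w \in S) @^-1` [set true]).
  rewrite (_ : _ @^-1` _ = ~` (h @^-1` ~` S)).
    exact: (@measurableC _ (g_sigma_algebraType gens) _
      (measurable_vec_open mh (closed_openC cS))).
  apply/seteqP; split => w /=; first by move=> /set_mem Sw; exact.
  by move=> /contrapT Sw; rewrite mem_set.
rewrite (_ : (fun w => _) = (fun w => if h w \in S then h w 0 j else c 0 j)); last first.
  by apply/funext => w; case: ifP.
apply: measurable_fun_ifT => //.
by apply: (measurable_fun_bool true); rewrite setTI.
Qed.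

Lemma rvec_measurable_contraction gens (h k : Omega -> 'rV[R]_d) :
  rvec_measurable <<s gens>> h ->
  (forall w w', enorm (k w - k w') <= enorm (h w - h w')) ->
  rvec_measurable <<s gens>> k.
Proof.
move=> /rvec_measurableP mh hk; apply/rvec_measurableP.
exact: (measurable_vec_contraction (T := g_sigma_algebraType gens) mh hk).
Qed.

End sub_sigma_algebras.

(** * Orthogonality to functions measurable for a sub-sigma-algebra *)

Import HBNNSimple.

Section pull_out.
Context {R : realType} {dO : measure_display} {Omega : measurableType dO}.
Context (P : probability Omega R) (gens : set (set Omega)).
Hypothesis gens_sub : <<s gens>> `<=` measurable.

Let sub_measurable (Z : Omega -> R) :
  rv_measurable <<s gens>> Z -> measurable_fun setT Z.
Proof. by move=> mZ _ B mB; rewrite setTI; apply: gens_sub; exact: mZ. Qed.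

(** The hypothesis on events extends to simple functions by linearity, then to [Z] by dominated
    convergence with bound [k * |W|]. *)
Lemma integral_ortho_ge0 (W Z : Omega -> R) k :
  P.-integrable setT (EFin \o W) ->
  (forall A, <<s gens>> A -> \int[P]_(w in A) (W w)%:E = 0)%E ->
  rv_measurable <<s gens>> Z -> (forall w, 0 <= Z w <= k) ->
  (\int[P]_w (Z w * W w)%:E = 0)%E.
Proof.
move=> iW W0 mZ Zk.
(* The approximation is carried out over this type so that the level sets of the simple functions
   belong to [<<s gens>>]. *)
pose T := g_sigma_algebraType gens.
pose f : T -> \bar R := EFin \o Z.
have mf : measurable_fun [set: T] f.
  by apply: measurableT_comp => //; exact/rv_measurableP.
have f0 w : [set: T] w -> (0 <= f w)%E.
  by move=> _; rewrite /f/= lee_fin; case/andP: (Zk w).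
pose phi n : T -> R := nnsfun_approx measurableT mf n.
have phiZ n w : 0 <= phi n w <= Z w.
  apply/andP; split; first exact: fun_ge0.
  by have := @le_approx _ _ _ _ _ n _ f0 I; rewrite /phi nnsfun_approxE => /(_ w).
have mphi n : rv_measurable <<s gens>> (phi n) by apply/rv_measurableP.
have ind0 A c : <<s gens>> A ->
    P.-integrable setT (fun w => (c * \1_A w * W w)%:E) /\
    (\int[P]_w (c * \1_A w * W w)%:E = 0)%E.
  move=> gA; have mA := gens_sub gA.
  have E w : (c * \1_A w * W w)%:E = (c%:E * ((EFin \o W) \_ A) w)%E.
    by rewrite patchE indicE; case: ifP => _;
      rewrite ?mulr1 ?mulr0 ?mul0r ?mule0// EFinM.
  have iA : P.-integrable setT ((EFin \o W) \_ A).
    by apply/(integrable_mkcond _ mA)/(integrableS measurableT).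
  split.
    by apply: eq_integrable (integrableZl measurableT c iA) => // w _; rewrite E.
  under eq_integral do rewrite E.
  by rewrite integralZl// -integral_mkcond W0// mule0.
have sum0 I (s : seq I) (c : I -> R) (A : I -> set Omega) :
    (forall i, <<s gens>> (A i)) ->
    P.-integrable setT (fun w => (\sum_(i <- s) c i * \1_(A i) w * W w)%:E) /\
    (\int[P]_w (\sum_(i <- s) c i * \1_(A i) w * W w)%:E = 0)%E.
  move=> gA; elim: s => [|i s [IH1 IH2]].
    split; last by under eq_integral do rewrite big_nil; rewrite integral0.
    by apply: eq_integrable (integrable0 P setT) => // w _; rewrite big_nil.
  have [I1 I2] := ind0 (A i) (c i) (gA i).
  split.
    apply: eq_integrable (integrableD measurableT I1 IH1) => // w _.
    by rewrite big_cons EFinD.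
  under eq_integral do rewrite big_cons EFinD.
  by rewrite integralD// I2 IH2 adde0.
have phi0 n : (\int[P]_w (phi n w * W w)%:E = 0)%E.
  under eq_integral do rewrite /phi fimfunEord mulr_suml.
  apply: (sum0 _ _ _ _ _).2 => i; apply: mphi.
  exact: measurable_set1.
have mW : measurable_fun setT W by apply/measurable_EFinP; case/integrableP: iW.
have [|||||_ _] := @dominated_convergence _ _ _ P setT measurableT
  (fun n w => (phi n w * W w)%:E) (fun w => (Z w * W w)%:E)
  (fun w => (k%:E * `|(W w)%:E|)%E).
- by move=> n; apply/measurable_EFinP/measurable_funM => //; exact: sub_measurable.
- by apply/measurable_EFinP/measurable_funM => //; exact: sub_measurable.
- apply/aeW => w _; apply: cvg_EFin; first exact: nearW.
  apply: cvgM; last exact: cvg_cst.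
  exact: fine_cvg (cvg_nnsfun_approx measurableT mf f0 I).
- exact/integrableZl/integrable_abse.
- apply/aeW => w n _; rewrite abse_EFin normrM -EFinM lee_fin.
  have /andP[p0 pz] := phiZ n w; rewrite ger0_norm// ler_wpM2r//.
  by rewrite (le_trans pz)//; case/andP: (Zk w).
rewrite (_ : [sequence _]_n = (fun=> 0%E)); last by apply/funext => n; exact: phi0.
by move/(cvg_lim (@ereal_hausdorff R)); rewrite lim_cst.
Qed.

End pull_out.

(** * Conditional expectations *)

Section conditional_drift.
Context {R : realType} {dO : measure_display} {Omega : measurableType dO} {d : nat}.
Context (P : probability Omega R) (gens : set (set Omega)).
Hypothesis gens_sub : <<s gens>> `<=` measurable.
Implicit Types (X Y Z : Omega -> 'rV[R]_d).

(** Shifting [Z] by [k] reduces to the nonnegative case; the shift contributes [k] times the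
    integral of [W] over the whole space, which is 0. *)
Lemma integral_ortho (W Z : Omega -> R) k :
  P.-integrable setT (EFin \o W) ->
  (forall A, <<s gens>> A -> \int[P]_(w in A) (W w)%:E = 0)%E ->
  rv_measurable <<s gens>> Z -> (forall w, `|Z w| <= k) ->
  P.-integrable setT (fun w => (Z w * W w)%:E) /\
  (\int[P]_w (Z w * W w)%:E = 0)%E.
Proof.
move=> iW W0 mZ Zk.
have mZ' : measurable_fun setT Z.
  by move=> _ B mB; rewrite setTI; apply: gens_sub; exact: mZ.
have iZW : P.-integrable setT (fun w => (Z w * W w)%:E).
  apply: (le_integrable measurableT _ _ (integrableZl measurableT k iW)).
    apply/measurable_EFinP/measurable_funM => //.
    by apply/measurable_EFinP; case/integrableP: iW.
  move=> w _; rewrite -EFinM !abse_EFin lee_fin !normrM ler_wpM2r//.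
  by rewrite (le_trans (Zk w))// ler_norm.
split=> //.
have ikW : P.-integrable setT (fun w => (k * W w)%:E) := integrableZl measurableT k iW.
have <- := @integral_ortho_ge0 _ _ _ P gens gens_sub W (fun w => Z w + k) (k + k) iW W0.
- under [RHS]eq_integral do rewrite mulrDl EFinD.
  rewrite integralD//; under [X in (_ = _ + X)%E]eq_integral do rewrite EFinM.
  rewrite integralZl// W0 ?mule0 ?adde0//.
  exact: (@measurableT _ (g_sigma_algebraType gens)).
- apply/rv_measurableP; apply: measurable_funD => //; exact/rv_measurableP.
- by move=> w; have := Zk w; rewrite ler_norml; lra.
Qed.

Lemma cond_expectation_ortho X Y Z k :
  is_cond_expectation P <<s gens>> X Y ->
  rvec_measurable <<s gens>> Z -> (forall w j, `|Z w 0 j| <= k) ->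
  P.-integrable setT (fun w => (dotp (X w - Y w) (Z w))%:E) /\
  (\int[P]_w (dotp (X w - Y w) (Z w))%:E = 0)%E.
Proof.
move=> [mY XY] mZ Zk; rewrite /dotp.
elim: (index_enum _) => [|j s [IH1 IH2]].
  split; last by under eq_integral do rewrite big_nil; rewrite integral0.
  by apply: eq_integrable (integrable0 P setT) => // w _; rewrite big_nil.
have [iX iY XYj] := XY j.
have iW : P.-integrable setT (EFin \o (fun w => (X w - Y w) 0 j)).
  apply: eq_integrable (integrableB measurableT iX iY) => // w _.
  by rewrite /= !mxE EFinB.
have [||w|I1 I2] := @integral_ortho _ (fun w => Z w 0 j) k iW.
- move=> A gA; under eq_integral do rewrite !mxE EFinB.
  rewrite integralB//; try by apply: (integrableS measurableT) => //; exact: gens_sub.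
  + have -> := XYj A gA; rewrite subee//.
    apply: (integrable_fin_num (gens_sub gA)).
    by apply: (integrableS measurableT) => //; exact: gens_sub.
  + exact: gens_sub.
- exact: mZ.
- exact: Zk.
split.
  apply: eq_integrable (integrableD measurableT I1 IH1) => // w _.
  by rewrite big_cons EFinD mulrC.
under eq_integral do rewrite big_cons EFinD mulrC.
by rewrite integralD// I2 IH2 adde0.
Qed.

(* [Z] need not be bounded: truncate it on the events [|Z|^2 <= k]. *)
Lemma cond_expectation_le X Y Z (phi : Omega -> R) :
  is_cond_expectation P <<s gens>> X Y -> rvec_measurable <<s gens>> Z ->
  P.-integrable setT (EFin \o phi) ->
  P.-integrable setT (fun w => (dotp (X w) (Z w))%:E) ->
  (forall w, phi w <= dotp (Y w) (Z w)) ->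
  \int[P]_w phi w <= \int[P]_w dotp (X w) (Z w).
Proof.
move=> XY mZ iphi iXZ phiYZ.
pose A k := [set w | dotp (Z w) (Z w) <= k%:R].
have gA k : <<s gens>> (A k).
  have -> : A k = Z @^-1` [set z | dotp (z - 0) (z - 0) <= k%:R].
    by apply/seteqP; split => w; rewrite /A/= subr0.
  have mZ' := (rvec_measurableP gens Z).1 mZ.
  rewrite (_ : [set z | _] = ~` [set z | k%:R < dotp (z - 0) (z - 0)]); last first.
    by apply/seteqP; split => z /=; rewrite leNgt => /negP.
  rewrite preimage_setC.
  have oV : open [set z : 'rV[R]_d | k%:R < dotp (z - 0) (z - 0)].
    have /continuousP := @continuous_dotp R d 0.
    by move=> /(_ _ (@open_gt R k%:R)).
  exact: (@measurableC _ (g_sigma_algebraType gens) _ (measurable_vec_open mZ' oV)).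
have mA k : measurable (A k) := gens_sub (gA k).
pose Zk k w := if w \in A k then Z w else 0.
have mZk k : rvec_measurable <<s gens>> (Zk k).
  move=> j; apply/rv_measurableP.
  rewrite (_ : (fun w => Zk k w 0 j) = fun w => Z w 0 j * \1_(A k) w); last first.
    by apply/funext => w; rewrite indicE /Zk; case: ifP; rewrite ?mulr1 ?mulr0 ?mxE.
  apply: measurable_funM; first exact/rv_measurableP.
  exact: (@measurable_indic _ (g_sigma_algebraType gens) R setT (A k) (gA k)).
(* On [A k] the square of a coordinate is at most [k], hence at most [(1 + k) ^+ 2]. *)
have Zkb k w j : `|Zk k w 0 j| <= 1 + k%:R.
  rewrite /Zk; case: ifPn; rewrite ?inE => h; last by rewrite mxE normr0 addr_ge0.
  have := le_trans (sqr_coord_le_dotp (Z w) j) h.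
  rewrite -(@real_normK _ (Z w 0 j)) ?num_real// => {}h.
  rewrite leNgt; apply/negP => h2.
  have : (1 + k%:R) ^+ 2 < `|Z w 0 j| ^+ 2 by rewrite ltr_sqr ?nnegrE ?addr_ge0.
  by have : 0 <= k%:R :> R by []; nra.
pose psi w := dotp (X w) (Z w) - phi w.
have ipsi : P.-integrable setT (EFin \o psi).
  by apply: eq_integrable (integrableB measurableT iXZ iphi).
(* On [A k], [psi] dominates [dotp (X - Y) Z] because [phi <= dotp Y Z]; truncated to [A k], the
   latter has integral 0. *)
have psik k : (0 <= \int[P]_w (psi w * \1_(A k) w)%:E)%E.
  have [I1 <-] := cond_expectation_ortho XY (mZk k) (Zkb k).
  apply: le_integral => //.
    have iA : P.-integrable (A k) (EFin \o psi) by exact: (integrableS measurableT).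
    apply: eq_integrable ((integrable_mkcond (EFin \o psi) (mA k)).1 iA) => // w _.
    by rewrite patchE indicE /=; case: ifP; rewrite ?mulr1 ?mulr0.
  move=> w _; rewrite lee_fin indicE /Zk; case: ifP => _.
    by rewrite mulr1 dotpDl dotpNl lerD2l lerN2.
  by rewrite mulr0 dotpC -(scale0r 0) dotpZl mul0r.
have mpsi : measurable_fun setT psi by apply/measurable_EFinP; case/integrableP: ipsi.
have [|||||_ _] := @dominated_convergence _ _ _ P setT measurableT
  (fun k w => (psi w * \1_(A k) w)%:E) (EFin \o psi)
  (fun w => `|(psi w)%:E|%E).
- move=> k; apply/measurable_EFinP/measurable_funM => //.
- exact/measurable_EFinP.
- apply/aeW => w _; apply: cvg_EFin; first exact: nearW.
  rewrite /comp/= -[X in _ --> X]mulr1; apply: cvgM; first exact: cvg_cst.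
  apply: cvg_near_cst; near=> k.
  rewrite indicE mem_set// /A/=; near: k; exact: nbhs_infty_ger.
- exact: integrable_abse.
- apply/aeW => w k _; rewrite !abse_EFin lee_fin normrM indicE.
  by case: (w \in A k); rewrite ?normr1 ?mulr1 ?normr0 ?mulr0.
move=> h; rewrite -subr_ge0 -RintegralB//.
have : (0 <= \int[P]_w (EFin \o psi) w)%E.
  move/cvg_lim: (h) => <- //.
  by apply: lime_ge; [apply/cvg_ex; eexists; exact: h|exact: nearW].
by rewrite /Rintegral => ?; exact: fine_ge0.
Unshelve. all: by end_near. Qed.

End conditional_drift.

(** * The mean-square recursion *)

Section one_step.
Context {R : realType} {dO : measure_display} {Omega : measurableType dO} {d : nat}.
Context (P : probability Omega R).

Lemma moment2E (h : Omega -> 'rV[R]_d) :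
  moment P 2 h = (\int[P]_w (dotp (h w) (h w))%:E)%E.
Proof.
by rewrite /moment unlock; apply: eq_integral => w _; rewrite enorm_sqr.
Qed.

Lemma moment2_ge0 (h : Omega -> 'rV[R]_d) : (0 <= moment P 2 h)%E.
Proof. by rewrite moment2E; apply: integral_ge0 => w _; rewrite lee_fin dotp_ge0. Qed.

Lemma moment2_fin_num (h : Omega -> 'rV[R]_d) :
  (moment P 2 h < +oo)%E -> moment P 2 h \is a fin_num.
Proof. by rewrite ge0_fin_numE// moment2_ge0. Qed.

Lemma fine_moment2_le (h : Omega -> 'rV[R]_d) r :
  (moment P 2 h <= r%:E)%E -> fine (moment P 2 h) <= r.
Proof.
move=> hr; rewrite -lee_fin fineK//.
exact: moment2_fin_num (le_lt_trans hr (ltry _)).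
Qed.

Lemma moment2_integrable (h : Omega -> 'rV[R]_d) : measurable_vec h ->
  (moment P 2 h < +oo)%E -> P.-integrable setT (fun w => (dotp (h w) (h w))%:E).
Proof.
move=> mh; rewrite moment2E => hoo; apply/integrableP; split.
  exact/measurable_EFinP/measurable_vec_dotp.
by under eq_integral do rewrite gee0_abs ?lee_fin ?dotp_ge0//.
Qed.

Lemma dotp_integrable (h k : Omega -> 'rV[R]_d) :
  measurable_vec h -> measurable_vec k ->
  (moment P 2 h < +oo)%E -> (moment P 2 k < +oo)%E ->
  P.-integrable setT (fun w => (dotp (h w) (k w))%:E).
Proof.
move=> mh mk hoo koo.
have := integrableD measurableT (moment2_integrable mh hoo) (moment2_integrable mk koo).
apply: le_integrable => //; first exact/measurable_EFinP/measurable_vec_dotp.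
move=> w _; rewrite -EFinD !abse_EFin lee_fin.
rewrite [leRHS]ger0_norm; last by rewrite addr_ge0 ?dotp_ge0.
have := dotp_ge0 (h w); have := dotp_ge0 (k w).
have := dotp_ge0 (h w + k w); have := dotp_ge0 (h w - k w).
by rewrite dotpBB dotpDD ler_norml; lra.
Qed.

Lemma moment2D_lty (h k : Omega -> 'rV[R]_d) :
  measurable_vec h -> measurable_vec k ->
  (moment P 2 h < +oo)%E -> (moment P 2 k < +oo)%E ->
  (moment P 2 (fun w => h w + k w)%R < +oo)%E.
Proof.
move=> mh mk hoo koo; rewrite moment2E; apply: integrable_lty => //.
apply: eq_integrable (integrableD measurableT (integrableD measurableT
  (moment2_integrable mh hoo) (integrableZl measurableT 2 (dotp_integrable mh mk hoo koo)))
  (moment2_integrable mk koo)) => // w _.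
by rewrite dotpDD !EFinD EFinM.
Qed.

Lemma moment2Z_lty a (h : Omega -> 'rV[R]_d) : measurable_vec h ->
  (moment P 2 h < +oo)%E -> (moment P 2 (fun w => a *: h w)%R < +oo)%E.
Proof.
move=> mh hoo; rewrite moment2E; apply: integrable_lty => //.
apply: eq_integrable (integrableZl measurableT (a * a) (moment2_integrable mh hoo)) => // w _.
by rewrite dotpZl dotpZr mulrA EFinM.
Qed.

Context (gens : set (set Omega)).
Hypothesis gens_sub : <<s gens>> `<=` measurable.

(** The square of [x - gam *: g - xs] is expanded, and only the cross term needs conditioning. The
    new iterate [y] enters through an almost sure inequality, which both recursions satisfy. The
    weight [c] of the AM-GM inequality is left free, to be matched later to the bias. *)
Lemma descent_step (S : set 'rV[R]_d) (F : 'rV[R]_d -> R) xs mu c gam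
    (x y g gs Y : Omega -> 'rV[R]_d) :
  convex_set (S : set (convex_lmodType 'rV[R]_d)) -> S xs ->
  (forall y, F xs <= F y) -> quasi_strongly_convex S F xs mu ->
  0 < c -> 0 <= gam ->
  (forall w, S (x w)) -> rvec_measurable <<s gens>> x ->
  measurable_vec y -> measurable_vec g -> measurable_vec gs ->
  (moment P 2 (fun w => x w - xs)%R < +oo)%E ->
  (moment P 2 (fun w => g w - gs w)%R < +oo)%E ->
  (moment P 2 gs < +oo)%E ->
  is_cond_expectation P <<s gens>> g Y ->
  (moment P 2 (fun w => Y w - grad F (x w))%R < +oo)%E ->
  {ae P, forall w, enorm (y w - xs) <= enorm (x w - gam *: g w - xs)} ->
  (moment P 2 (fun w => y w - xs)%R < +oo)%E /\
  fine (moment P 2 (fun w => y w - xs)) <=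
    (1 - gam * (2 * mu - c)) * fine (moment P 2 (fun w => x w - xs))
    + gam / c * fine (moment P 2 (fun w => Y w - grad F (x w)))
    + 2 * gam ^+ 2 * (fine (moment P 2 (fun w => g w - gs w)) + fine (moment P 2 gs)).
Proof.
move=> cS Sxs Fmin qscF c0 gam0 Sx mGx my mg mgs xoo goo gsoo gY hoo yx.
have [dF _ _ _] := qscF.
have mx : measurable_vec x := rvec_measurable_vec gens_sub mGx.
have mY : measurable_vec Y := rvec_measurable_vec gens_sub gY.1.
have mcst : measurable_vec (fun _ : Omega => xs) by move=> j; exact: measurable_cst.
have mZ := measurable_vecB mx mcst.
have mD := measurable_vecB mg mgs.
have mH := measurable_vecB mY (measurable_vec_grad mx dF).
have mgx := measurable_vecZ gam mg.
have mN := measurable_vecB (measurable_vecB mx mgx) mcst.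
have mGZ : rvec_measurable <<s gens>> (fun w => x w - xs).
  apply/rvec_measurableP/measurable_vecB; first exact/rvec_measurableP.
  by move=> j; exact: measurable_cst.
have gfin : (moment P 2 g < +oo)%E.
  have := moment2D_lty mD mgs goo gsoo.
  by under eq_fun do rewrite subrK.
have noo : (moment P 2 (fun w => x w - gam *: g w - xs)%R < +oo)%E.
  have := moment2D_lty mZ (measurable_vecZ (- gam) mg) xoo (moment2Z_lty (- gam) mg gfin).
  by under eq_fun do rewrite scaleNr addrAC.
have le_yn : (moment P 2 (fun w => y w - xs)%R <=
              moment P 2 (fun w => x w - gam *: g w - xs)%R)%E.
  rewrite !moment2E; apply: ae_ge0_le_integral => //.
  - by move=> w _; rewrite lee_fin dotp_ge0.
  - by apply/measurable_EFinP/measurable_vec_dotp; exact: measurable_vecB.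
  - by move=> w _; rewrite lee_fin dotp_ge0.
  - by apply/measurable_EFinP/measurable_vec_dotp.
  - by apply: filterS yx => w + _; rewrite ler_enorm lee_fin.
have yoo := le_lt_trans le_yn noo.
split=> //.
have {le_yn} le_yn : fine (moment P 2 (fun w => y w - xs)) <=
    fine (moment P 2 (fun w => x w - gam *: g w - xs)).
  by rewrite fine_le// moment2_fin_num.
apply: (le_trans le_yn).
rewrite !moment2E -!/(Rintegral P setT _).
have iZ := moment2_integrable mZ xoo.
have iH := moment2_integrable mH hoo.
have iD := moment2_integrable mD goo.
have iS := moment2_integrable mgs gsoo.
have iN := moment2_integrable mN noo.
have igZ := dotp_integrable mg mZ gfin xoo.
set IN := Rintegral _ _ _; set IZ := Rintegral _ _ _; set IH := Rintegral _ _ _.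
set ID := Rintegral _ _ _; set IS := Rintegral _ _ _.
pose IgZ := \int[P]_w dotp (g w) (x w - xs).
have iM a (f : Omega -> R) : P.-integrable setT (fun w => (f w)%:E) ->
    P.-integrable setT (EFin \o (fun w => a * f w)).
  by move=> i; apply: eq_integrable (integrableZl measurableT a i).
(* The left-hand side integrates a minorant of the product of [Y] with [x - xs], integrable by the
   moment bounds: monotonicity of the gradient gives [mu], and AM-GM pays [c / 2] and [(2 * c)^-1]
   for the bias. *)
have h1 : (mu - c / 2) * IZ - (2 * c)^-1 * IH <= IgZ.
  rewrite /IZ /IH -!RintegralZl// -RintegralB//; try exact: iM.
  apply: (cond_expectation_le gens_sub gY mGZ) => //.
    by apply: eq_integrable (integrableB measurableT (iM _ _ iZ) (iM _ _ iH)).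
  move=> w.
  have := quasi_strongly_convex_monotone cS Sxs Fmin qscF (Sx w).
  set Zw := x w - xs; set Hw := Y w - _; set Gw := grad F (x w).
  have -> : Y w = Gw + Hw by rewrite addrC subrK.
  have := dotp_ge0 (c *: Zw + Hw); rewrite dotpDD !(dotpZl, dotpZr) dotpDl => q1 q2.
  rewrite (dotpC Hw).
  (* This is the square of [c *: Zw + Hw] divided by [2 * c]. *)
  have q3 : 0 <= c / 2 * dotp Zw Zw + dotp Zw Hw + (2 * c)^-1 * dotp Hw Hw.
    rewrite (_ : _ + _ = (2 * c)^-1 *
      (c * (c * dotp Zw Zw) + 2 * (c * dotp Zw Hw) + dotp Hw Hw)).
      by rewrite mulr_ge0// invr_ge0 mulr_ge0// ltW.
    by field; rewrite gt_eqF.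
  by lra.
have h2 : IN <= IZ - 2 * gam * IgZ + 2 * gam ^+ 2 * (ID + IS).
  rewrite /IZ /ID /IS /IgZ -RintegralD// -!RintegralZl//; last first.
    by apply: eq_integrable (integrableD measurableT iD iS).
  have iDS : P.-integrable setT (EFin \o (fun w => 2 * gam ^+ 2 *
      (dotp (g w - gs w) (g w - gs w) + dotp (gs w) (gs w)))).
    by apply: eq_integrable (integrableZl measurableT (2 * gam ^+ 2)
      (integrableD measurableT iD iS)).
  have igZ' : P.-integrable setT (EFin \o (fun w => 2 * gam * dotp (g w) (x w - xs))).
    by apply: eq_integrable (integrableZl measurableT (2 * gam) igZ).
  have iZg : P.-integrable setT (EFin \o
      (fun w => dotp (x w - xs) (x w - xs) - 2 * gam * dotp (g w) (x w - xs))).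
    by apply: eq_integrable (integrableB measurableT iZ igZ').
  rewrite -RintegralB// -RintegralD//.
  apply: le_Rintegral => //.
    by apply: eq_integrable (integrableD measurableT iZg iDS).
  move=> w _.
  have -> : x w - gam *: g w - xs = (x w - xs) - gam *: g w by rewrite addrAC.
  rewrite [leLHS]dotpBB dotpZl !dotpZr (dotpC (x w - xs) (g w)).
  have q : dotp (g w) (g w) <= 2 * (dotp (g w - gs w) (g w - gs w) + dotp (gs w) (gs w)).
    have := dotp_ge0 (g w - gs w - gs w).
    have -> : dotp (g w) (g w) = dotp ((g w - gs w) + gs w) ((g w - gs w) + gs w).
      by rewrite subrK.
    by rewrite [X in 0 <= X]dotpBB [dotp (_ + gs w) _]dotpDD; lra.
  have := ler_wpM2l (sqr_ge0 gam) q; rewrite expr2.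
  by lra.
have h3 : gam * ((mu - c / 2) * IZ - (2 * c)^-1 * IH) <= gam * IgZ.
  by rewrite ler_wpM2l.
have h4 : gam / c * IH = 2 * (gam * ((2 * c)^-1 * IH)).
  by field; rewrite gt_eqF.
by rewrite h4; lra.
Qed.

End one_step.

(** * Adaptedness of the iterates and the gradient step *)

Section iterates.
Context {R : realType} {dO : measure_display} {Omega : measurableType dO} {d : nat}.
Context (P : probability Omega R).
Context (n : nat -> nat) (f : nat -> nat -> Omega -> 'rV[R]_d -> R).
Hypothesis rl : random_losses n f.

Lemma filtration_measurable t : filtration n f t `<=` measurable.
Proof.
apply: smallest_sub; first exact: sigma_algebra_measurable.
move=> A [i [x [B [/andP[i0 _] mB ->]]]]; rewrite -[X in measurable X]setTI.
suff mb : measurable_fun setT (fun w => batch_loss n f i w x) by exact: mb.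
apply: measurable_funM => //; apply: measurable_sum => k.
exact: (rl i0 (ltn_ord k)).1.
Qed.

Lemma filtrationS t : filtration n f t `<=` filtration n f t.+1.
Proof.
apply: sub_sigma_algebra2 => A [i [x [B [/andP[i0 it] mB ->]]]].
by exists i, x, B; split => //; rewrite i0 ltnW.
Qed.

Lemma batch_gradE t w x : (0 < t)%N ->
  batch_grad n f t w x = (n t)%:R^-1 *: \sum_(i < n t) grad (f t i w) x.
Proof.
move=> t0; apply/rowP => j; rewrite /batch_grad !mxE summxE.
have df (i : 'I_(n t)) : differentiable (f t i w) x by exact: (rl t0 (ltn_ord i)).2.
have E : batch_loss n f t w = (n t)%:R^-1 \*: \sum_(i < n t) f t i w.
  by apply/funext => y; rewrite /batch_loss/= fct_sumE.
have ds : derivable (\sum_(i < n t) f t i w) x (delta_mx 0 j).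
  by apply: derivable_sum => i; exact: diff_derivable.
rewrite -deriveE; last first.
  rewrite E; apply: differentiableZ; apply: differentiable_sum => i; exact: df.
rewrite E deriveZ// derive_sum; last by move=> i; exact: diff_derivable.
congr (_ *: _); apply: eq_bigr => i _.
by rewrite mxE deriveE.
Qed.

Lemma sgd_stepE gamma t w x : (0 < t)%N ->
  sgd_step n f gamma t w x = x - gamma t *: batch_grad n f t w x.
Proof. by move=> t0; rewrite /sgd_step batch_gradE// scalerA. Qed.

Lemma rvec_measurableS t (h : Omega -> 'rV[R]_d) :
  rvec_measurable (filtration n f t) h -> rvec_measurable (filtration n f t.+1) h.
Proof. by move=> mh j B mB; apply: filtrationS; exact: mh. Qed.

Lemma sgd_step_measurable gamma t (h : Omega -> 'rV[R]_d) :
  rfield_measurable (filtration n f t.+1) (batch_grad n f t.+1) ->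
  rvec_measurable (filtration n f t) h ->
  rvec_measurable (filtration n f t.+1) (fun w => sgd_step n f gamma t.+1 w (h w)).
Proof.
move=> mg /rvec_measurableS mh.
have mgh := rfield_measurable_comp mg mh.
rewrite (_ : (fun w => _) =
  fun w => h w - gamma t.+1 *: batch_grad n f t.+1 w (h w)); last first.
  by apply/funext => w; rewrite sgd_stepE.
apply/rvec_measurableP.
by apply: measurable_vecB; [|apply: measurable_vecZ]; exact/rvec_measurableP.
Qed.

Lemma cst_rvec_measurable t (c : 'rV[R]_d) :
  rvec_measurable (filtration n f t) (fun _ : Omega => c).
Proof. by apply/rvec_measurableP => j; exact: measurable_cst. Qed.

Context (S : set 'rV[R]_d) (xs x0 : 'rV[R]_d) (gamma : nat -> R).
Context (theta : nat -> Omega -> 'rV[R]_d).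
Hypothesis Sxs : S xs.
Hypothesis Sx0 : S x0.
Hypothesis cS : closed S.
Hypothesis convS : convex_set (S : set (convex_lmodType 'rV[R]_d)).
Hypothesis mg : forall t,
  rfield_measurable (filtration n f t.+1) (batch_grad n f t.+1).

(* [SSG] stays in [S] only almost surely, whereas admissible points lie in [S]
   everywhere: its iterates are redefined as [xs] outside [S]. *)
Lemma SSG_PSSG_iterates :
  SSG P n f S gamma x0 theta \/ PSSG n f S gamma x0 theta ->
  exists x_ : nat -> Omega -> 'rV[R]_d,
    [/\ forall w, x_ 0%N w = x0,
        forall t w, S (x_ t w),
        forall t, rvec_measurable (filtration n f t) (x_ t) /\
          rvec_measurable (filtration n f t) (theta t),
        forall t, {ae P, forall w, x_ t w = theta t w} &
        forall t, {ae P, forall w, enorm (x_ t.+1 w - xs) <=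
          enorm (x_ t w - gamma t.+1 *: batch_grad n f t.+1 w (x_ t w) - xs)}].
Proof.
case=> [[th0 thS aeS]|[th0 thS]].
  have mth t : rvec_measurable (filtration n f t) (theta t).
    elim: t => [|t IH].
      by rewrite (_ : theta 0%N = fun=> x0);
        [exact: cst_rvec_measurable|apply/funext].
    rewrite (_ : theta t.+1 = fun w => sgd_step n f gamma t.+1 w (theta t w)).
      exact: sgd_step_measurable.
    by apply/funext => w; rewrite thS.
  exists (fun t w => if theta t w \in S then theta t w else xs); split.
  - by move=> w; rewrite th0 mem_set.
  - by move=> t w; case: ifPn => // /set_mem.
  - by move=> t; split=> //; apply: (closed_if_measurable xs cS); exact: mth.
  - by move=> t; apply: filterS (aeS t) => w Sw; rewrite mem_set.
  (* Where two consecutive iterates lie in [S] the redefinition changes nothing, and the inequality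
     is an equality. *)
  - move=> t; apply: filterS2 (aeS t) (aeS t.+1) => w Sw Sw1.
    by rewrite !mem_set// thS sgd_stepE.
have Sth t w : S (theta t w) by case: t => [|t]; rewrite ?th0//; case: (thS t w).
have mth t : rvec_measurable (filtration n f t) (theta t).
  elim: t => [|t IH].
    by rewrite (_ : theta 0%N = fun=> x0);
      [exact: cst_rvec_measurable|apply/funext].
  apply: (rvec_measurable_contraction (sgd_step_measurable gamma (@mg t) IH)) => w w'.
  exact: is_projection_nonexpansive (thS t w) (thS t w').
exists theta; split => //.
- by move=> t; exact: aeW.
- move=> t; apply: aeW => w; rewrite -sgd_stepE//.
  (* The point [xs] is its own projection, so projecting does not increase the distance to it. *)
  exact: is_projection_nonexpansive (thS t w) (is_projection_id Sxs).
Qed.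

End iterates.

(** * Second moments along the iterates *)

Section mean_square_recursion.
Context {R : realType} {dO : measure_display} {Omega : measurableType dO} {d : nat}.
Context (P : probability Omega R).

(* Weighted AM-GM with weight [c = D nu + mu / 2] turns the bias bound into
   [2 D nu dl] plus a term of order [nu^2 B^2 / mu]. *)
Lemma descent_constants (mu D B C nu gam sig dl h gd gs : R) :
  0 < mu -> 0 <= D -> 0 <= nu -> 0 <= gam -> 0 <= dl ->
  let c := D * nu + mu / 2 in
  h <= nu ^+ 2 * (D ^+ 2 * dl + B ^+ 2) ->
  gd <= C ^+ 2 * dl -> gs <= sig ^+ 2 ->
  (1 - gam * (2 * mu - c)) * dl + gam / c * h + 2 * gam ^+ 2 * (gd + gs) <=
  (1 - gam * (3 / 2 * mu - 2 * D * nu) + 2 * C ^+ 2 * gam ^+ 2) * dl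
  + gam * (2 * nu ^+ 2 * B ^+ 2 / mu + 2 * gam * sig ^+ 2).
Proof.
move=> mu0 D0 nu0 gam0 dl0 c h1 h2 h3.
have Dnu0 : 0 <= D * nu by rewrite mulr_ge0.
have c0 : 0 < c by rewrite ltr_wpDl// divr_gt0.
have Dc : D * nu <= c by rewrite /c; lra.
have mc : mu / 2 <= c by rewrite /c; lra.
(* [D * nu <= c] serves for the part of [h] proportional to [dl], and [mu / 2 <= c] for the constant
   part. *)
have q1 : h / c <= D * nu * dl + 2 * nu ^+ 2 * B ^+ 2 / mu.
  rewrite ler_pdivrMr//; apply: (le_trans h1).
  have e1 : (D * nu * dl) * (D * nu) <= (D * nu * dl) * c.
    by rewrite ler_wpM2l// mulr_ge0.
  have e2 : (2 * nu ^+ 2 * B ^+ 2 / mu) * (mu / 2) <=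
            (2 * nu ^+ 2 * B ^+ 2 / mu) * c.
    rewrite ler_wpM2l// divr_ge0 ?(ltW mu0)//.
    by rewrite mulr_ge0 ?sqr_ge0// mulr_ge0// sqr_ge0.
  have e3 : (2 * nu ^+ 2 * B ^+ 2 / mu) * (mu / 2) = nu ^+ 2 * B ^+ 2.
    by field; rewrite gt_eqF.
  rewrite e3 in e2; rewrite mulrDl.
  by rewrite (_ : nu ^+ 2 * _ = (D * nu * dl) * (D * nu)
       + nu ^+ 2 * B ^+ 2); [exact: lerD|ring].
have q2 : gam / c * h <=
    gam * (D * nu * dl + 2 * nu ^+ 2 * B ^+ 2 / mu).
  by rewrite mulrAC -mulrA ler_wpM2l.
have q3 : gam ^+ 2 * (gd + gs) <=
    gam ^+ 2 * (C ^+ 2 * dl + sig ^+ 2).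
  by rewrite ler_wpM2l ?sqr_ge0// lerD.
rewrite [leRHS](_ : _ = (1 - gam * (2 * mu - c)) * dl +
    gam * (D * nu * dl + 2 * nu ^+ 2 * B ^+ 2 / mu) +
    2 * (gam ^+ 2 * (C ^+ 2 * dl + sig ^+ 2))); last first.
  by rewrite /c; field; rewrite gt_eqF.
by rewrite -[2 * gam ^+ 2 * _]mulrA lerD ?lerD2l// ler_wpM2l.
Qed.

(** An iterate is admissible only if its second moment is finite, so finiteness is propagated by
    induction together with the inequality. Everything is proved for the redefined iterates [x_] and
    transferred to [theta] by almost sure equality. *)
Lemma mean_square_recursion (n : nat -> nat) (f : nat -> nat -> Omega -> 'rV[R]_d -> R)
    (S : set 'rV[R]_d) (F : 'rV[R]_d -> R) (xs x0 : 'rV[R]_d)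
    (mu D B C : R) (gamma nu_ sigma_ : nat -> R) (theta : nat -> Omega -> 'rV[R]_d) :
  random_losses n f -> closed S -> convex_set (S : set (convex_lmodType 'rV[R]_d)) ->
  S xs -> S x0 -> (forall y, F xs <= F y) -> quasi_strongly_convex S F xs mu ->
  0 <= D -> (forall t, (0 < t)%N -> 0 <= gamma t) ->
  dependence_bias P n f 2 S F xs nu_ D B ->
  expected_smoothness P n f 2 S xs C -> gradient_noise P n f 2 xs sigma_ ->
  SSG P n f S gamma x0 theta \/ PSSG n f S gamma x0 theta ->
  exists delta : nat -> R,
    (forall t, 0 <= delta t) /\
    (forall t, moment P 2 (fun w => theta t w - xs) = (delta t)%:E) /\
    (forall t, delta t.+1 <=
      (1 - gamma t.+1 * (3 / 2 * mu - 2 * D * nu_ t.+1)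
         + 2 * C ^+ 2 * gamma t.+1 ^+ 2) * delta t
      + gamma t.+1 * (2 * nu_ t.+1 ^+ 2 * B ^+ 2 / mu
                      + 2 * gamma t.+1 * sigma_ t.+1 ^+ 2)).
Proof.
move=> rl cS convS Sxs Sx0 Fmin qscF D0 gam0 dep smo noi rec.
have [_ _ mu0 _] := qscF.
have mg t : rfield_measurable (filtration n f t.+1) (batch_grad n f t.+1).
  by have [] := dep t.+1 isT.
have [x_ [x_0 Sx_ mxth x_th x_step]] := SSG_PSSG_iterates rl Sxs Sx0 cS convS mg rec.
have mx_ t := (mxth t).1.
have mfx t : measurable_vec (x_ t).
  exact: rvec_measurable_vec (filtration_measurable rl (t := t)) (mx_ t).
have mZ t : measurable_vec (fun w => x_ t w - xs).
  by apply: measurable_vecB => // j; exact: measurable_cst.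
have step t : (moment P 2 (fun w => x_ t w - xs)%R < +oo)%E ->
  (moment P 2 (fun w => x_ t.+1 w - xs)%R < +oo)%E /\
  fine (moment P 2 (fun w => x_ t.+1 w - xs)) <=
      (1 - gamma t.+1 * (3 / 2 * mu - 2 * D * nu_ t.+1)
         + 2 * C ^+ 2 * gamma t.+1 ^+ 2) * fine (moment P 2 (fun w => x_ t w - xs))
      + gamma t.+1 * (2 * nu_ t.+1 ^+ 2 * B ^+ 2 / mu
                      + 2 * gamma t.+1 * sigma_ t.+1 ^+ 2).
  move=> xoo.
  have adm : admissible P n f 2 S xs t.+1 (x_ t) by split.
  have [nu0 _ _ /(_ _ adm)[Y gY hY]] := dep t.+1 isT.
  have gD := smo t.+1 isT _ adm.
  have [sig0 gS] := noi t.+1 isT.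
  have dfin := moment2_fin_num xoo.
  set dl := fine (moment P 2 (fun w => x_ t w - xs)).
  have dE : moment P 2 (fun w => x_ t w - xs) = dl%:E by rewrite fineK.
  have dl0 : 0 <= dl by rewrite fine_ge0// moment2_ge0.
  rewrite dE -EFinM in hY.
  rewrite dE -EFinM in gD.
  have hoo := le_lt_trans hY (ltry _).
  have goo := le_lt_trans gD (ltry _).
  have soo := le_lt_trans gS (ltry _).
  have mgx := rvec_measurable_vec (filtration_measurable rl (t := t.+1))
     (rfield_measurable_comp (mg t) (rvec_measurableS (mx_ t))).
  have mgs := rvec_measurable_vec (filtration_measurable rl (t := t.+1))
     (rfield_measurable_comp (mg t) (cst_rvec_measurable xs)).
  have Dnu0 : 0 <= D * nu_ t.+1 by rewrite mulr_ge0// ltW.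
  pose c := D * nu_ t.+1 + mu / 2.
  have c0 : 0 < c by rewrite ltr_wpDl// divr_gt0.
  have gm0 := gam0 t.+1 isT.
  have [yoo le_y] := descent_step (filtration_measurable rl (t := t)) convS Sxs Fmin qscF
    c0 gm0 (Sx_ t) (mx_ t) (mfx t.+1) mgx mgs xoo goo soo gY hoo (x_step t).
  have key h gd gs := @descent_constants mu D B C (nu_ t.+1) (gamma t.+1)
    (sigma_ t.+1) dl h gd gs mu0 D0 (ltW nu0) gm0 dl0.
  split=> //; apply: (le_trans le_y); apply: key.
  - exact: fine_moment2_le hY.
  - exact: fine_moment2_le gD.
  - exact: fine_moment2_le gS.
have oo t : (moment P 2 (fun w => x_ t w - xs)%R < +oo)%E.
  elim: t => [|t IH]; last by case: (step t IH).
  rewrite moment2E; under eq_integral do rewrite x_0.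
  by rewrite integral_cst//= probability_setT mule1 ltry.
exists (fun t => fine (moment P 2 (fun w => x_ t w - xs))); split.
  by move=> t; rewrite fine_ge0// moment2_ge0.
split=> t; last by case: (step t (oo t)).
rewrite fineK ?moment2_fin_num// !moment2E.
have mth : measurable_vec (theta t).
  exact: rvec_measurable_vec (filtration_measurable rl (t := t)) (mxth t).2.
apply: ae_eq_integral => //.
- apply/measurable_EFinP/measurable_vec_dotp; apply: measurable_vecB => // j;
    exact: measurable_cst.
- by apply/measurable_EFinP/measurable_vec_dotp.
- by apply: filterS (x_th t) => w xw _; rewrite /= xw.
Qed.

End mean_square_recursion.

(** * Real recursions with power step sizes *)

Section power_sequences.
Context {R : realType}.
Implicit Types (a c e q m x y s : R) (t : nat).

Lemma powRDp a x y : 0 < a -> a `^ (x + y) = a `^ x * a `^ y.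
Proof. by move=> a0; rewrite powRD// (gt_eqF a0) implybT. Qed.

Lemma ge_powR_eventually x a : 0 < a ->
  exists T, forall t, (T <= t)%N -> x <= t%:R `^ a.
Proof.
move=> a0; have [x0|x0] := leP x 0.
  by exists 0%N => t _; rewrite (le_trans x0)// powR_ge0.
exists `|Num.ceil (x `^ a^-1)|%N => t Tt.
have xt : x `^ a^-1 <= t%:R.
  rewrite (le_trans (ceil_ge _))// (le_trans (ler_norm _))//.
  by rewrite -intr_norm -natr_absz ler_nat.
have -> : x = (x `^ a^-1) `^ a by rewrite -powRrM mulVf ?gt_eqF// powRr1// ltW.
by apply: ge0_ler_powR; rewrite ?nnegrE ?powR_ge0// ltW.
Qed.

Lemma powRN_le_eventually x a : 0 < a -> 0 < x ->
  exists T, forall t, (T <= t)%N -> (0 < t)%N -> t%:R `^ (- a) <= x.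
Proof.
move=> a0 x0; have [T hT] := ge_powR_eventually x^-1 a0.
by exists T => t Tt t0; rewrite powRN invf_ple ?posrE ?hT ?powR_gt0 ?ltr0n.
Qed.

(** The ratio of the two powers is [(1 + 1 / t) ^ e <= exp (e / t) <= 1 + 2 * e / t] for large [t],
    and [1 / t] is eventually below any positive multiple of [t.+1 ^ (- q)] because [q < 1]. *)
Lemma powRN_ratio_eventually e c q : 0 <= e -> 0 < c -> q < 1 ->
  exists T, forall t, (T <= t)%N -> (0 < t)%N ->
    t%:R `^ (- e) <= (1 + c * t.+1%:R `^ (- q)) * t.+1%:R `^ (- e).
Proof.
move=> e0 c0 q1.
have q1' : 0 < 1 - q by rewrite subr_gt0.
(* In the 4, one factor 2 comes from [expR y <= 1 + 2 * y] and the other from [t + 1 <= 2 * t]. *)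
have [T1 hT1] := ge_powR_eventually (4 * e / c) q1'.
have [T2 hT2] := ge_powR_eventually (2 * e) (@ltr01 R).
exists (maxn T1 T2) => t; rewrite geq_max => /andP[T1t T2t] t0.
have t0' : 0 < t%:R :> R by rewrite ltr0n.
have t10 : 0 < t.+1%:R :> R by rewrite ltr0n.
have h1 : 4 * e / c <= t.+1%:R `^ (1 - q) by apply: hT1; rewrite ltnW.
have h2 : 2 * e <= t%:R by rewrite -(powRr1 (ltW t0')); exact: hT2.
set y := e / t%:R.
have y0 : 0 <= y by rewrite divr_ge0// ltW.
have y2 : 2 * y <= 1 by rewrite /y mulrA ler_pdivrMr// mul1r.
have v0 : 0 < 1 + t%:R^-1 :> R by rewrite ltr_pwDl// invr_ge0 ltW.
have ratio : t%:R `^ (- e) = (1 + t%:R^-1) `^ e * t.+1%:R `^ (- e).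
  rewrite (_ : t.+1%:R = t%:R * (1 + t%:R^-1) :> R); last first.
    by rewrite -natr1 mulrDr mulr1 divff// gt_eqF.
  by rewrite powRM ?ltW// mulrCA -powRDp// subrr powRr0 mulr1.
rewrite ratio ler_wpM2r ?powR_ge0//.
have h3 : (1 + t%:R^-1) `^ e <= expR y.
  rewrite /powR gt_eqF// ler_expR /y ler_wpM2l// -ler_expR lnK ?posrE//.
  exact: expR_ge1Dx.
apply: (le_trans h3).
have h4 : expR y <= 1 + 2 * y.
  have := expR_ge1Dx (- y); rewrite expRN => h4.
  have E0 := expR_gt0 y.
  have h5 : (1 - y) * expR y <= 1 by rewrite -ler_pdivlMr// mul1r.
  have h6 : 1 <= (1 + 2 * y) * (1 - y) by nra.
  have y1 : 0 < 1 - y by lra.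
  by rewrite -(ler_pM2l y1) (le_trans h5)// mulrC.
apply: (le_trans h4); rewrite lerD2l.
rewrite (_ : - q = (1 - q) + -1); last by ring.
rewrite powRDp// (powR_inv1 (ltW t10)).
rewrite [leRHS]mulrA ler_pdivlMr//.
have h5 : 4 * e <= c * t.+1%:R `^ (1 - q) by rewrite [leRHS]mulrC -ler_pdivrMr.
apply: le_trans h5; rewrite /y -natr1 mulrA mulrAC ler_pdivrMr//.
have : 1 <= t%:R :> R by rewrite ler1n.
by nra.
Qed.

(** Every term is bounded below by the value of the power at [T + k]. This forgoes the factor
    [1 / (1 - q)] of an integral comparison and leaves a constant free of [q]. *)
Lemma sum_powRN_ge (gam : nat -> R) c q T k : 0 <= c -> 0 <= q <= 1 -> (0 < T)%N ->
  (forall t, (T <= t)%N -> c * t.+1%:R `^ (- q) <= gam t.+1) ->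
  c * ((T + k)%:R `^ (1 - q) - T%:R) <= \sum_(i < k) gam (T + i).+1.
Proof.
move=> c0 /andP[q0 q1] T0 hg.
have Tk0 : 0 < (T + k)%:R :> R by rewrite ltr0n addn_gt0 T0.
apply: (@le_trans _ _ (\sum_(i < k) c * (T + k)%:R `^ (- q))).
  have -> : \sum_(i < k) c * (T + k)%:R `^ (- q) = c * ((T + k)%:R `^ (- q) * k%:R).
    by rewrite sumr_const card_ord -[LHS]mulr_natr mulrA.
  rewrite ler_wpM2l// powRDp// (powRr1 (ltW Tk0)).
  have : (T + k)%:R `^ (- q) <= 1 :> R.
    rewrite -[leRHS](powRr0 (T + k)%:R) ler_powR ?oppr_le0// ler1n.
    by rewrite addn_gt0 T0.
  by have : 0 <= T%:R :> R by []; rewrite natrD; nra.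
apply: ler_sum => i _; apply: le_trans (hg _ (leq_addr _ _)).
rewrite ler_wpM2l// !powRN lef_pV2 ?posrE ?powR_gt0//.
by apply: ge0_ler_powR; rewrite ?nnegrE// ler_nat -addnS leq_add2l.
Qed.

(* [w] is a supersolution of the recursion, so that [delta - w] contracts. *)
Lemma recursion_bound (delta gam : nat -> R) m c q e1 e2 s1 s2 T0 :
  0 < m -> 0 < c -> 0 <= q < 1 -> 0 <= e1 -> 0 <= e2 -> 0 <= s1 -> 0 <= s2 ->
  (forall t, 0 <= delta t) ->
  (forall t, (T0 <= t)%N -> c * t.+1%:R `^ (- q) <= gam t.+1) ->
  (forall t, (T0 <= t)%N -> m * gam t.+1 <= 1) ->
  (forall t, (T0 <= t)%N -> delta t.+1 <= (1 - m * gam t.+1) * delta t +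
      gam t.+1 * (s1 * t.+1%:R `^ (- e1) + s2 * t.+1%:R `^ (- e2))) ->
  exists T K, 0 <= K /\ forall t, (T <= t)%N ->
    delta t <= K * expR (- (m * c * t%:R `^ (1 - q)))
               + 2 * s1 / m * t%:R `^ (- e1) + 2 * s2 / m * t%:R `^ (- e2).
Proof.
move=> m0 c0 /andP[q0 q1] e10 e20 s10 s20 d0 gam_ge gam_le rec.
have mc0 : 0 < m * c / 2 by rewrite divr_gt0// mulr_gt0.
have [T1 hT1] := powRN_ratio_eventually e10 mc0 q1.
have [T2 hT2] := powRN_ratio_eventually e20 mc0 q1.
pose T := maxn (maxn T0 1) (maxn T1 T2).
have [TT0 TT1 TT2 T_gt0] : [/\ (T0 <= T)%N, (T1 <= T)%N, (T2 <= T)%N & (0 < T)%N].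
  by rewrite /T !leq_max !leqnn !orbT.
pose w t := 2 * s1 / m * t%:R `^ (- e1) + 2 * s2 / m * t%:R `^ (- e2).
have w0 t : 0 <= w t.
  by rewrite addr_ge0// mulr_ge0 ?powR_ge0// divr_ge0 ?mulr_ge0// ltW.
have gam0 t : (T0 <= t)%N -> 0 <= gam t.+1.
  by move=> Tt; rewrite (le_trans _ (gam_ge t Tt))// mulr_ge0 ?powR_ge0// ltW.
(* With [a = m * gam t.+1], the ratio bound gives the factor [(1 - a) * (1 + a / 2)] and the forcing
   term adds [a / 2]; the total is [1 - a ^+ 2 / 2]. This is why the multiple is [2 * s / m]. *)
have super e s t : 0 <= s -> (T <= t)%N ->
    t%:R `^ (- e) <= (1 + m * c / 2 * t.+1%:R `^ (- q)) * t.+1%:R `^ (- e) ->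
    (1 - m * gam t.+1) * (2 * s / m * t%:R `^ (- e)) + gam t.+1 * (s * t.+1%:R `^ (- e))
    <= 2 * s / m * t.+1%:R `^ (- e).
  move=> s0 Tt h; have T0t := leq_trans TT0 Tt.
  have g1 := gam_le t T0t; have g2 := gam_ge t T0t; have g0 := gam0 t T0t.
  set z := t.+1%:R `^ (- e); rewrite -/z in h.
  have z0 : 0 <= z by exact: powR_ge0.
  have k0 : 0 <= 2 * s / m by rewrite divr_ge0 ?mulr_ge0// ltW.
  set k := 2 * s / m in k0 *.
  have -> : s = k * (m / 2) by rewrite /k; field; rewrite gt_eqF.
  have h' : t%:R `^ (- e) <= (1 + m * gam t.+1 / 2) * z.
    apply: (le_trans h); rewrite ler_wpM2r// lerD2l.
    by have := ler_wpM2l (ltW m0) g2; lra.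
  have h2 : (1 - m * gam t.+1) * t%:R `^ (- e) <=
      (1 - m * gam t.+1) * ((1 + m * gam t.+1 / 2) * z).
    by rewrite ler_wpM2l// subr_ge0.
  have h3 : 0 <= (m * gam t.+1) ^+ 2 * z by rewrite mulr_ge0 ?sqr_ge0.
  rewrite (_ : _ + _ = k * ((1 - m * gam t.+1) * t%:R `^ (- e) +
     m * gam t.+1 / 2 * z)); last by ring.
  by rewrite ler_wpM2l//; lra.
have main k : delta (T + k)%N <= w (T + k)%N +
    delta T * expR (- (m * \sum_(i < k) gam (T + i).+1)).
  elim: k => [|k IH].
    by rewrite addn0 big_ord0 mulr0 oppr0 expR0 mulr1 lerDr.
  have Tk : (T <= T + k)%N by exact: leq_addr.
  have T0k := leq_trans TT0 Tk; have Tk0 := leq_trans T_gt0 Tk.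
  have := rec _ T0k; rewrite addnS => /le_trans; apply.
  set E := expR _ in IH *.
  have mg0 : 0 <= 1 - m * gam (T + k).+1 by rewrite subr_ge0 gam_le.
  have := ler_wpM2l mg0 IH => h1.
  have h2 := super e1 s1 _ s10 Tk (hT1 _ (leq_trans TT1 Tk) Tk0).
  have h3 := super e2 s2 _ s20 Tk (hT2 _ (leq_trans TT2 Tk) Tk0).
  rewrite big_ord_recr/= [m * (_ + gam _)]mulrDr opprD expRD -/E.
  have dE0 : 0 <= delta T * E by rewrite mulr_ge0// expR_ge0.
  have h4 := ler_wpM2l dE0 (expR_ge1Dx (- (m * gam (T + k).+1))).
  by rewrite /w in h1 *; lra.
(* The exponential factor pays for the [- T] in the lower bound on the sum of the steps. *)
exists T, (delta T * expR (m * c * T%:R)); split.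
  by rewrite mulr_ge0// expR_ge0.
move=> t Tt; have := main (t - T)%N; rewrite subnKC// => /le_trans; apply.
rewrite -[leRHS]addrA [leRHS]addrC lerD2l.
rewrite -[leRHS]mulrA -expRD; apply: ler_wpM2l => //; rewrite ler_expR.
have := @sum_powRN_ge gam c q T (t - T) (ltW c0).
rewrite q0 (ltW q1) subnKC// => /(_ isT T_gt0) h.
have {}h : c * (t%:R `^ (1 - q) - T%:R) <= \sum_(i < t - T) gam (T + i).+1.
  by apply: h => i Ti; apply: gam_ge; exact: leq_trans Ti.
by have := ler_wpM2l (ltW m0) h; lra.
Qed.

End power_sequences.

(** * Comparison of the schedules with pure powers of [t] *)

Section schedule_bounds.
Context {R : realType}.
Context (Crho : nat) (rho : R).
Hypotheses (Crho0 : (0 < Crho)%N) (rho0 : 0 <= rho).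
Implicit Types (a e x alpha beta nu sigma : R) (t : nat).

Let CR0 : 0 < Crho%:R :> R. Proof. by rewrite ltr0n. Qed.

Let tR0 t : (0 < t)%N -> 0 < t%:R :> R. Proof. by rewrite ltr0n. Qed.

Let x0 t : (0 < t)%N -> 0 < Crho%:R * t%:R `^ rho.
Proof. by move=> t0; rewrite mulr_gt0// powR_gt0// tR0. Qed.

(** The rounded quantity is at least 1, so rounding it up at most doubles it. *)
Lemma batch_size_bounds t : (0 < t)%N ->
  Crho%:R * t%:R `^ rho <= (batch_size Crho rho t)%:R <= 2 * (Crho%:R * t%:R `^ rho).
Proof.
move=> t0; set x := Crho%:R * _.
have x1 : 1 <= x.
  rewrite /x -[leLHS]mulr1 ler_pM ?ler1n//.
  by rewrite -[leLHS](powRr0 t%:R) ler_powR// ler1n.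
have c0 : 0 <= Num.ceil x by rewrite ceil_ge0; lra.
rewrite /batch_size -/x natr_absz ger0_norm// ceil_ge/=.
have /andP[+ _] := ceil_itv x; rewrite intrB.
by lra.
Qed.

Lemma batch_size_gt0 t : (0 < t)%N -> 0 < (batch_size Crho rho t)%:R :> R.
Proof.
move=> t0; have /andP[h _] := batch_size_bounds t0.
exact: lt_le_trans (x0 t0) h.
Qed.

Lemma powR_schedule t e : (0 < t)%N ->
  (Crho%:R * t%:R `^ rho) `^ e = Crho%:R `^ e * t%:R `^ (rho * e).
Proof. by move=> t0; rewrite powRM ?powR_ge0// powRrM. Qed.

Lemma batch_size_powR_ge t e : (0 < t)%N -> 0 <= e ->
  Crho%:R `^ e * t%:R `^ (rho * e) <= (batch_size Crho rho t)%:R `^ e.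
Proof.
move=> t0 e0; rewrite -powR_schedule//.
have /andP[h _] := batch_size_bounds t0.
by apply: ge0_ler_powR; rewrite ?nnegrE// ltW// x0.
Qed.

Lemma batch_size_powRN_le t e : (0 < t)%N -> 0 <= e ->
  (batch_size Crho rho t)%:R `^ (- e) <= Crho%:R `^ (- e) * t%:R `^ (- (rho * e)).
Proof.
move=> t0 e0; rewrite !powRN -invfM lef_pV2 ?posrE ?powR_gt0 ?batch_size_gt0//.
  exact: batch_size_powR_ge.
by rewrite mulr_gt0// powR_gt0// tR0.
Qed.

(** One factor 2 serves both signs of [e], as is needed for the exponent [beta - 2 * sigma], whose
    sign is not determined. *)
Lemma batch_size_powR_le t e : (0 < t)%N -> -1 <= e <= 1 ->
  (batch_size Crho rho t)%:R `^ e <= 2 * (Crho%:R `^ e * t%:R `^ (rho * e)).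
Proof.
move=> t0 /andP[em1 e1]; have [e0|e0] := leP 0 e.
  have /andP[_ h] := batch_size_bounds t0.
  apply: (@le_trans _ _ ((2 * (Crho%:R * t%:R `^ rho)) `^ e)).
    by apply: ge0_ler_powR; rewrite ?nnegrE// mulr_ge0// ltW// x0.
  rewrite powRM ?(ltW (x0 t0))// powR_schedule//.
  rewrite ler_wpM2r ?mulr_ge0 ?powR_ge0//.
  by apply: ler1_powR => //; rewrite ler1n.
have := @batch_size_powRN_le t (- e) t0.
rewrite oppr_ge0 (ltW e0) mulrN !opprK => /(_ isT) /le_trans; apply.
have : 0 <= Crho%:R `^ e * t%:R `^ (rho * e) by rewrite mulr_ge0 ?powR_ge0.
by lra.
Qed.

Lemma total_size_gt0 t : (0 < t)%N -> 0 < (total_size Crho rho t)%:R :> R.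
Proof.
case: t => // t _; rewrite ltr0n /total_size big_nat_recr//= addn_gt0.
by rewrite -[X in _ || X](ltr0n R) batch_size_gt0// orbT.
Qed.

Lemma total_size_le t : (0 < t)%N ->
  (total_size Crho rho t)%:R <= 2 * (Crho%:R * t%:R `^ (1 + rho)) :> R.
Proof.
move=> t0; rewrite /total_size natr_sum.
apply: (@le_trans _ _ (\sum_(1 <= i < t.+1) 2 * (Crho%:R * t%:R `^ rho))).
  rewrite big_nat_cond [leRHS]big_nat_cond; apply: ler_sum => i.
  rewrite andbT => /andP[i0 it].
  have /andP[_ h] := batch_size_bounds i0; apply: (le_trans h).
  rewrite !ler_wpM2l//.
  by apply: ge0_ler_powR; rewrite ?nnegrE// ler_nat -ltnS.
rewrite sumr_const_nat subn1/= -[leLHS]mulr_natr powRDp ?tR0// powRr1//.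
by rewrite le_eqVlt; apply/orP; left; apply/eqP; ring.
Qed.

Lemma total_size_powR_le t e : (0 < t)%N -> 0 <= e ->
  (total_size Crho rho t)%:R `^ (e / (1 + rho)) <=
  2 `^ (e / (1 + rho)) * (Crho%:R `^ (e / (1 + rho)) * t%:R `^ e).
Proof.
move=> t0 e0.
have r1 : 0 < 1 + rho by rewrite ltr_pwDl.
have e0' : 0 <= e / (1 + rho) by rewrite divr_ge0// ltW.
apply: (@le_trans _ _ ((2 * (Crho%:R * t%:R `^ (1 + rho))) `^ (e / (1 + rho)))).
  apply: ge0_ler_powR => //; last exact: total_size_le.
    by rewrite nnegrE.
  by rewrite nnegrE !mulr_ge0 ?powR_ge0.
rewrite !powRM ?mulr_ge0 ?powR_ge0// -powRrM.
by rewrite (_ : (1 + rho) * (e / (1 + rho)) = e)//; field; rewrite gt_eqF.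
Qed.

(** Trading [t] for [N_t], of order at most [Crho * t ^ (1 + rho)], uses up [e / (1 + rho)] of the
    exponent of [Crho]; the remainder [y] is the exponent of [Crho] in the final bound. *)
Lemma total_size_powRN_ge t e a y : (0 < t)%N -> 0 <= e ->
  e / (1 + rho) + y = a ->
  Crho%:R `^ (- a) * t%:R `^ (- e) <= 2 `^ (e / (1 + rho)) /
    (Crho%:R `^ y * (total_size Crho rho t)%:R `^ (e / (1 + rho))).
Proof.
move=> t0 e0 <-; rewrite powRN [t%:R `^ _]powRN -invfM.
have N0 := total_size_gt0 t0.
rewrite -[leLHS]div1r ler_pdivlMr; last by rewrite mulr_gt0// powR_gt0.
rewrite mulrAC mul1r ler_pdivrMr; last by rewrite mulr_gt0// powR_gt0// tR0.
rewrite powRDp// mulrC.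
by have := ler_wpM2l (powR_ge0 Crho%:R y) (total_size_powR_le t0 e0); lra.
Qed.

Lemma learning_rate_bounds Cgamma beta alpha t : (0 < t)%N -> 0 < Cgamma ->
  0 <= beta <= 1 ->
  Cgamma * Crho%:R `^ beta * t%:R `^ (- (alpha - rho * beta)) <=
  learning_rate Cgamma beta alpha Crho rho t <=
  2 * (Cgamma * Crho%:R `^ beta * t%:R `^ (- (alpha - rho * beta))).
Proof.
move=> t0 C0 /andP[b0 b1]; rewrite /learning_rate.
rewrite (_ : - (alpha - rho * beta) = rho * beta + - alpha); last by ring.
rewrite powRDp ?tR0//.
have h1 := batch_size_powR_ge t0 b0.
have h2 : (batch_size Crho rho t)%:R `^ beta <= 2 * (Crho%:R `^ beta * t%:R `^ (rho * beta)).
  by apply: batch_size_powR_le => //; rewrite b1 andbT; lra.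
have C1 : 0 <= Cgamma * t%:R `^ (- alpha) by rewrite mulr_ge0 ?powR_ge0// ltW.
have := ler_wpM2l C1 h1; have := ler_wpM2l C1 h2.
by lra.
Qed.

Lemma learning_rate_ge0 Cgamma beta alpha t : 0 < Cgamma ->
  0 <= learning_rate Cgamma beta alpha Crho rho t.
Proof. by move=> C0; rewrite !mulr_ge0 ?powR_ge0// ltW. Qed.

Lemma bias_rate_sqr_le nu t : (0 < t)%N -> 0 < nu ->
  bias_rate nu Crho rho t ^+ 2 <= Crho%:R `^ (- (2 * nu)) * t%:R `^ (- (2 * rho * nu)).
Proof.
move=> t0 nu0; rewrite /bias_rate -powR_mulrn ?powR_ge0// -powRrM.
rewrite (_ : - nu * 2%:R = - (2 * nu)); last by ring.
rewrite (_ : 2 * rho * nu = rho * (2 * nu)); last by ring.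
by apply: batch_size_powRN_le => //; rewrite mulr_ge0// ltW.
Qed.

(** The powers of the batch size in the step and in the noise are merged before the comparison, so
    rounding costs a single factor 2. *)
Lemma noise_rate_sqr_le Csigma Cgamma sigma beta alpha t : (0 < t)%N ->
  0 < Cgamma -> 0 <= beta <= 1 -> 0 <= sigma <= 1 / 2 ->
  learning_rate Cgamma beta alpha Crho rho t * noise_rate Csigma sigma Crho rho t ^+ 2
  <= 2 * (Csigma ^+ 2 * Cgamma * Crho%:R `^ (- (2 * sigma - beta)))
     * t%:R `^ (- (alpha - rho * beta + 2 * rho * sigma)).
Proof.
move=> t0 C0 /andP[b0 b1] /andP[s0 s1].
rewrite /learning_rate /noise_rate exprMn -[(_ `^ (- sigma)) ^+ 2]powR_mulrn ?powR_ge0//.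
rewrite -powRrM; set N := (batch_size Crho rho t)%:R.
rewrite (_ : - (alpha - rho * beta + 2 * rho * sigma) =
  rho * (- (2 * sigma - beta)) + - alpha); last by ring.
rewrite powRDp ?tR0//.
have h : N `^ (- (2 * sigma - beta)) <=
  2 * (Crho%:R `^ (- (2 * sigma - beta)) * t%:R `^ (rho * - (2 * sigma - beta))).
  by apply: batch_size_powR_le => //; apply/andP; split; lra.
have E : N `^ beta * N `^ (- sigma * 2%:R) = N `^ (- (2 * sigma - beta)).
  by rewrite -powRDp ?batch_size_gt0//; congr (_ `^ _); ring.
have C1 : 0 <= Csigma ^+ 2 * Cgamma * t%:R `^ (- alpha).
  by rewrite mulr_ge0 ?powR_ge0// mulr_ge0 ?sqr_ge0// ltW.
rewrite (_ : _ * _ = Csigma ^+ 2 * Cgamma * t%:R `^ (- alpha) *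
  (N `^ beta * N `^ (- sigma * 2%:R))); last by ring.
rewrite E; have := ler_wpM2l C1 h.
by lra.
Qed.

(** For [rho = 0] the batch size is constantly [Crho], and positivity of [mu_nu] is the claim with
    strict inequality. For [rho > 0] the bias rate tends to 0; the threshold [mu / (2 * D + 1)]
    allows [D = 0]. *)
Lemma bias_rate_small nu D mu : 0 < nu -> 0 <= D -> 0 < mu ->
  0 < mu_nu mu D nu Crho rho ->
  exists T, forall t, (T <= t)%N -> (0 < t)%N -> 2 * D * bias_rate nu Crho rho t <= mu.
Proof.
move=> nu0 D0 mu0; rewrite /mu_nu; have [->|rhoN0] := eqVneq rho 0.
  rewrite mul1r => munu0; exists 0%N => t _ t0; rewrite /bias_rate.
  rewrite (_ : batch_size Crho 0 t = Crho); first by lra.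
  by rewrite /batch_size powRr0 mulr1 (_ : Crho%:R = (Crho : int)%:~R :> R)// intrKceil.
move=> _; have rho1 : 0 < rho by rewrite lt_neqAle eq_sym rhoN0.
have D1 : 0 < 2 * D + 1 by rewrite ltr_wpDl// mulr_ge0.
have [T hT] := powRN_le_eventually (mulr_gt0 rho1 nu0) (divr_gt0 mu0 D1).
exists T => t Tt t0.
have h1 : bias_rate nu Crho rho t <= mu / (2 * D + 1).
  apply: le_trans (hT t Tt t0); apply: (le_trans (batch_size_powRN_le t0 (ltW nu0))).
  rewrite -[leRHS]mul1r ler_wpM2r ?powR_ge0//.
  rewrite -[leRHS](powRr0 Crho%:R) ler_powR ?ler1n// oppr_le0; exact: ltW.
have h2 := ler_wpM2l (ltW D1) h1.
have h3 : (2 * D + 1) * (mu / (2 * D + 1)) = mu by field; rewrite gt_eqF.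
have : 0 <= bias_rate nu Crho rho t by exact: powR_ge0.
by rewrite h3 in h2; lra.
Qed.

End schedule_bounds.

(** * Assembly of the bound and bookkeeping of its constants *)

Theorem theorem1 (R : realType) (rho beta nu sigma : R)
    (hrho : 0 <= rho < 1) (hbeta : 0 <= beta <= 1) (hnu : 0 < nu)
    (hsigma : 0 <= sigma <= 1 / 2) :
  exists Cdelta Cdelta' Cdelta'' : R,
    [/\ 0 < Cdelta, 0 < Cdelta' & 0 < Cdelta''] /\
    forall (alpha : R), 1 / 2 < alpha - rho * beta < 1 ->
    forall (d : nat) (Theta : set 'rV[R]_d),
      closed Theta -> convex_set (Theta : set (convex_lmodType 'rV[R]_d)) ->
    forall (dX : measure_display) (X : measurableType dX) (Q : probability X R)
        (loss : 'rV[R]_d -> X -> R),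
      (forall x, Q.-integrable setT (EFin \o loss x)) ->
    forall (thetastar : 'rV[R]_d),
      Theta thetastar ->
      is_unique_global_minimizer (objective Q loss) thetastar ->
    forall (dO : measure_display) (Omega : measurableType dO)
        (P : probability Omega R)
        (f : nat -> nat -> Omega -> 'rV[R]_d -> R)
        (Crho : nat) (Cgamma Csigma mu D B Ckappa : R),
      (0 < Crho)%N -> 0 < Cgamma -> 0 < Csigma -> 0 <= D -> 0 <= B ->
      0 < Ckappa ->
    let n := batch_size Crho rho in
    let N := total_size Crho rho in
    let gamma := learning_rate Cgamma beta alpha Crho rho in
      random_losses n f ->
      quasi_strongly_convex Theta (objective Q loss) thetastar mu ->
      dependence_bias P n f 2 Theta (objective Q loss) thetastar
        (bias_rate nu Crho rho) D B ->
      expected_smoothness P n f 2 Theta thetastar Ckappa ->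
      gradient_noise P n f 2 thetastar (noise_rate Csigma sigma Crho rho) ->
    forall (theta0 : 'rV[R]_d) (theta : nat -> Omega -> 'rV[R]_d),
      Theta theta0 ->
      SSG P n f Theta gamma theta0 theta \/ PSSG n f Theta gamma theta0 theta ->
    let munu := mu_nu mu D nu Crho rho in
      0 < munu ->
    exists2 g : nat -> R,
      g =O_\oo (fun t : nat =>
        expR (- (mu * Cgamma
                   * (N t)%:R `^ ((1 + rho * beta - alpha) / (1 + rho))
                 / (Cdelta * Crho%:R `^ ((1 - beta - alpha) / (1 + rho))))))
    & forall t : nat, (0 < t)%N ->
      (moment P 2 (fun w => (theta t w - thetastar)%R) <=
       (g t
        + Cdelta' * B ^+ 2
          / (mu * munu * Crho%:R `^ (2 * nu / (1 + rho))
             * (N t)%:R `^ (2 * rho * nu / (1 + rho)))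
        + Cdelta'' * Csigma ^+ 2 * Cgamma
          / (munu * Crho%:R `^ ((2 * sigma - beta - alpha) / (1 + rho))
             * (N t)%:R `^ ((rho * (2 * sigma - beta) + alpha)
                              / (1 + rho))))%:E)%E.
Proof.
have /andP[rho0 rho1] := hrho.
(* Each constant contains the 4 of [m = mu / 4]. [8 = 4 * 2], the 2 from [N_t]. [16 = 4 * 2 * 2],
   from the supersolution and the AM-GM weight; the power of 2 comes from [N_t].
   [128 = 4 * 2 * 2 * 2 * 4], from the supersolution, the splitting of the squared gradient, the
   rounding of the batch size, and [N_t]. *)
exists 8, (16 * 2 `^ (2 * rho * nu / (1 + rho))), 128; split.
  by split => //; rewrite mulr_gt0// powR_gt0.
move=> alpha /andP[q_gt q1] d Theta cTheta convTheta dX X Q loss _ xs Sxs [Fmin _].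
move=> dO Omega P f Crho Cgamma Csigma mu D B Ckappa Crho0 Cg0 Cs0 D0 B0 Ck0 n N gamma.
move=> rl qsc dep smo noi x0 theta Sx0 rec munu munu0.
have [_ _ mu0 _] := qsc.
have CR0 : 0 < Crho%:R :> R by rewrite ltr0n.
have munu_le : munu <= mu.
  rewrite /munu /mu_nu gerBl mulr_ge0//.
  by rewrite mulr_ge0 ?powR_ge0// mulr_ge0.
have gam0 t : (0 < t)%N -> 0 <= gamma t by move=> _; exact: learning_rate_ge0.
have [delta [delta0 [momE recur]]] :=
  mean_square_recursion rl cTheta convTheta Sxs Sx0 Fmin qsc D0 gam0 dep smo noi rec.
set q := alpha - rho * beta in q_gt q1.
pose m := mu / 4.
pose c := Cgamma * Crho%:R `^ beta.
pose eb := 2 * rho * nu.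
pose es := q + 2 * rho * sigma.
pose sb := 2 * B ^+ 2 / mu * Crho%:R `^ (- (2 * nu)).
pose ss := 4 * (Csigma ^+ 2 * Cgamma * Crho%:R `^ (- (2 * sigma - beta))).
have m0 : 0 < m by rewrite divr_gt0.
have c0 : 0 < c by rewrite mulr_gt0// powR_gt0.
have q0 : 0 < q by lra.
have [sig0 sig1] : 0 <= sigma /\ sigma <= 1 / 2 by have /andP[] := hsigma.
have eb0 : 0 <= eb by rewrite !mulr_ge0// ltW.
have es0 : 0 <= es by rewrite addr_ge0 ?(ltW q0)// !mulr_ge0.
have sb0 : 0 <= sb.
  by rewrite mulr_ge0 ?powR_ge0// divr_ge0 ?(ltW mu0)// mulr_ge0// sqr_ge0.
have ss0 : 0 <= ss.
  by rewrite mulr_ge0// mulr_ge0 ?powR_ge0// mulr_ge0 ?sqr_ge0// ltW.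
have gamma_bounds t := @learning_rate_bounds R Crho rho Crho0 rho0 Cgamma beta alpha t.+1
  isT Cg0 hbeta.
have [Tb hTb] := bias_rate_small Crho0 rho0 hnu D0 mu0 munu0.
(* The first bound keeps [1 - m * gamma] nonnegative. The second makes the quadratic term at most
   [gamma * mu / 4], so that the rate left over is [3 / 2 * mu - mu - mu / 4 = m]. *)
pose eps := Num.min m^-1 (mu / (8 * Ckappa ^+ 2)).
have K0 : 0 < 8 * Ckappa ^+ 2 by rewrite mulr_gt0// exprn_gt0.
have eps0 : 0 < eps by rewrite lt_min invr_gt0 m0 divr_gt0.
have c20 : 0 < 2 * c by rewrite mulr_gt0.
have [Tg hTg] := powRN_le_eventually q0 (divr_gt0 eps0 c20).
have gamma_small t : (Tg <= t)%N -> gamma t.+1 <= eps.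
  move=> Tt; have /andP[_ h] := gamma_bounds t; apply: (le_trans h).
  have := ler_wpM2l (ltW c20) (hTg t.+1 (leqW Tt) isT).
  rewrite (_ : 2 * c * (eps / (2 * c)) = eps); first by rewrite -/q /c; lra.
  by field; rewrite gt_eqF.
have step t : (maxn Tb Tg <= t)%N -> delta t.+1 <= (1 - m * gamma t.+1) * delta t +
    gamma t.+1 * (sb * t.+1%:R `^ (- eb) + ss * t.+1%:R `^ (- es)).
  rewrite geq_max => /andP[Tbt Tgt]; apply: (le_trans (recur t)).
  have g0 := gam0 t.+1 isT; have gd0 := mulr_ge0 g0 (delta0 t).
  have geps : gamma t.+1 * (8 * Ckappa ^+ 2) <= mu.
    rewrite -ler_pdivlMr//; apply: (le_trans (gamma_small t Tgt)).
    by rewrite ge_min lexx orbT.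
  have hb := hTb t.+1 (leqW Tbt) isT.
  have h1 := ler_wpM2l gd0 geps; have h2 := ler_wpM2l gd0 hb.
  have h3 : 2 * bias_rate nu Crho rho t.+1 ^+ 2 * B ^+ 2 / mu <= sb * t.+1%:R `^ (- eb).
    have k0 : 0 <= 2 * B ^+ 2 / mu.
      by rewrite divr_ge0 ?(ltW mu0)// mulr_ge0// sqr_ge0.
    have := ler_wpM2l k0 (@bias_rate_sqr_le R Crho rho Crho0 rho0 nu t.+1 isT hnu).
    by rewrite /sb /eb; lra.
  have h4 : 2 * gamma t.+1 * noise_rate Csigma sigma Crho rho t.+1 ^+ 2 <=
      ss * t.+1%:R `^ (- es).
    have := @noise_rate_sqr_le R Crho rho Crho0 rho0 Csigma Cgamma sigma beta alpha
      t.+1 isT Cg0 hbeta hsigma.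
    by rewrite -/gamma /ss /es /q; lra.
  have h5 := ler_wpM2l g0 (lerD h3 h4).
  by rewrite /m; lra.
have [|||T [K [K_ge0 bound]]] := @recursion_bound R delta gamma m c q eb es sb ss
  (maxn Tb Tg) m0 c0 _ eb0 es0 sb0 ss0 delta0 _ _ step.
- by rewrite (ltW q0).
- by move=> t _; have /andP[] := gamma_bounds t.
- move=> t; rewrite geq_max => /andP[_ Tgt].
  rewrite mulrC -ler_pdivlMr// div1r; apply: (le_trans (gamma_small t Tgt)).
  by rewrite ge_min lexx.
pose target t := 16 * 2 `^ (2 * rho * nu / (1 + rho)) * B ^+ 2
    / (mu * munu * Crho%:R `^ (2 * nu / (1 + rho))
       * (N t)%:R `^ (2 * rho * nu / (1 + rho)))
  + 128 * Csigma ^+ 2 * Cgamma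
    / (munu * Crho%:R `^ ((2 * sigma - beta - alpha) / (1 + rho))
       * (N t)%:R `^ ((rho * (2 * sigma - beta) + alpha) / (1 + rho))).
have r1 : 0 < 1 + rho by rewrite ltr_pwDl.
have imunu : mu^-1 <= munu^-1 by rewrite lef_pV2.
have bias_target t : (0 < t)%N -> 2 * sb / m * t%:R `^ (- eb) <=
    16 * 2 `^ (2 * rho * nu / (1 + rho)) * B ^+ 2
    / (mu * munu * Crho%:R `^ (2 * nu / (1 + rho))
       * (N t)%:R `^ (2 * rho * nu / (1 + rho))).
  move=> t0; have N0 := total_size_gt0 Crho0 rho0 t0.
  have E : eb / (1 + rho) + 2 * nu / (1 + rho) = 2 * nu.
    by rewrite /eb; field; rewrite gt_eqF.
  have h := total_size_powRN_ge Crho0 rho0 t0 eb0 E; rewrite -/(N t) in h.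
  have a0 : 0 < Crho%:R `^ (2 * nu / (1 + rho)) by rewrite powR_gt0.
  have b0 : 0 < (N t)%:R `^ (eb / (1 + rho)) by rewrite powR_gt0.
  rewrite /sb /m -/eb; set a := Crho%:R `^ (2 * nu / (1 + rho)) in a0 h *.
  set b := (N t)%:R `^ _ in b0 h *; set W := 2 `^ _ in h *.
  set z := _ * _ in h.
  have z0 : 0 <= z by rewrite mulr_ge0 ?powR_ge0.
  have k0 : 0 <= 16 * B ^+ 2 / mu by rewrite divr_ge0 ?(ltW mu0)// mulr_ge0// sqr_ge0.
  have im0 : 0 <= mu^-1 by rewrite invr_ge0 ltW.
  have := ler_wpM2l k0 (ler_pM im0 z0 imunu h).
  rewrite (_ : 16 * B ^+ 2 / mu * (munu^-1 * (W / (a * b))) =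
    16 * W * B ^+ 2 / (mu * munu * a * b)); last first.
    by field; rewrite !gt_eqF.
  apply: le_trans; rewrite le_eqVlt; apply/orP; left; apply/eqP.
  by rewrite /z; field; rewrite gt_eqF.
have noise_target t : (0 < t)%N -> 2 * ss / m * t%:R `^ (- es) <=
    128 * Csigma ^+ 2 * Cgamma
    / (munu * Crho%:R `^ ((2 * sigma - beta - alpha) / (1 + rho))
       * (N t)%:R `^ ((rho * (2 * sigma - beta) + alpha) / (1 + rho))).
  move=> t0; have N0 := total_size_gt0 Crho0 rho0 t0.
  have E : es / (1 + rho) + (2 * sigma - beta - alpha) / (1 + rho) = 2 * sigma - beta.
    by rewrite /es /q; field; rewrite gt_eqF.
  have h := total_size_powRN_ge Crho0 rho0 t0 es0 E; rewrite -/(N t) in h.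
  have -> : (rho * (2 * sigma - beta) + alpha) / (1 + rho) = es / (1 + rho).
    by rewrite /es /q; field; rewrite gt_eqF.
  (* Since [es] involves [alpha], this power must be bounded by an absolute number. *)
  have W4 : 2 `^ (es / (1 + rho)) <= 4 :> R.
    rewrite (_ : 4 = 2 `^ 2%:R :> R); last by rewrite powR_mulrn// expr2; ring.
    rewrite ler_powR ?ler1n// ler_pdivrMr//.
    have : rho * sigma <= rho * (1 / 2) by rewrite ler_wpM2l.
    by rewrite /es; lra.
  have a0 : 0 < Crho%:R `^ ((2 * sigma - beta - alpha) / (1 + rho)) by rewrite powR_gt0.
  have b0 : 0 < (N t)%:R `^ (es / (1 + rho)) by rewrite powR_gt0.
  rewrite /ss /m; set a := Crho%:R `^ (_ / _) in a0 h *.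
  set b := (N t)%:R `^ _ in b0 h *; set W := 2 `^ _ in h W4.
  set z := _ * _ in h.
  have z0 : 0 <= z by rewrite mulr_ge0 ?powR_ge0.
  have {}h : z <= 4 / (a * b).
    apply: (le_trans h); rewrite ler_wpM2r// invr_ge0.
    by apply: ltW; rewrite mulr_gt0.
  have k0 : 0 <= 32 * (Csigma ^+ 2 * Cgamma).
    by rewrite mulr_ge0// mulr_ge0 ?sqr_ge0// ltW.
  have im0 : 0 <= mu^-1 by rewrite invr_ge0 ltW.
  have := ler_wpM2l k0 (ler_pM im0 z0 imunu h).
  rewrite (_ : 32 * (Csigma ^+ 2 * Cgamma) * (munu^-1 * (4 / (a * b))) =
    128 * Csigma ^+ 2 * Cgamma / (munu * a * b)); last first.
    by field; rewrite !gt_eqF.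
  apply: le_trans; rewrite le_eqVlt; apply/orP; left; apply/eqP.
  by rewrite /z; field; rewrite gt_eqF.
(* With this choice the inequality holds for every [t] by construction, and only the decay of [g]
   for large [t] remains. *)
exists (fun t => Num.max 0 (delta t - target t)); last first.
  move=> t t0; rewrite momE lee_fin -addrA -/(target t) -lerBlDr.
  by rewrite le_max lexx orbT.
apply/eqO_exP; exists (K + 1); first by rewrite ltr_wpDl.
exists (maxn T 1) => // t; rewrite /= geq_max => /andP[Tt t0].
rewrite [`|expR _|]ger0_norm ?expR_ge0// ger0_norm ?le_max ?lexx//.
have N0 := total_size_gt0 Crho0 rho0 t0.
rewrite ge_max mulr_ge0 ?addr_ge0 ?expR_ge0//=.
apply: (@le_trans _ _ (K * expR (- (m * c * t%:R `^ (1 - q))))).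
  have := bound t Tt; have := bias_target t t0; have := noise_target t t0.
  by rewrite /target; lra.
apply: ler_pM; [by []|exact: expR_ge0|by rewrite lerDl|].
rewrite ler_expR lerN2.
have q1' : 0 <= 1 - q by rewrite subr_ge0 ltW.
have := total_size_powR_le Crho0 rho0 t0 q1'; rewrite -/(N t).
have -> : (1 + rho * beta - alpha) / (1 + rho) = (1 - q) / (1 + rho).
  by rewrite /q; field; rewrite gt_eqF.
(* The factor [Crho ^ beta] split off here is the one contained in [c]. *)
have -> : Crho%:R `^ ((1 - q) / (1 + rho)) =
    Crho%:R `^ ((1 - beta - alpha) / (1 + rho)) * Crho%:R `^ beta :> R.
  by rewrite -powRDp//; congr (_ `^ _); rewrite /q; field; rewrite gt_eqF.
have W2 : 2 `^ ((1 - q) / (1 + rho)) <= 2 :> R.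
  apply: ler1_powR; first by rewrite ler1n.
  by rewrite ler_pdivrMr//; lra.
set b := (N t)%:R `^ _; set W := 2 `^ _ in W2 *.
have a0 : 0 < Crho%:R `^ ((1 - beta - alpha) / (1 + rho)) :> R by rewrite powR_gt0.
set a := Crho%:R `^ ((1 - beta - alpha) / (1 + rho)) in a0 *.
set u := t%:R `^ (1 - q) => h.
have {}h : b <= 2 * (a * Crho%:R `^ beta * u).
  by apply: (le_trans h); rewrite ler_wpM2r// !mulr_ge0 ?powR_ge0// ltW.
rewrite ler_pdivrMr ?mulr_gt0//.
have := ler_wpM2l (ltW (mulr_gt0 mu0 Cg0)) h.
by rewrite /m /c; lra.
Qed.
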